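(* Let the interval $I$, the weight $w$ on $I$, the contraction factors $k_N$ ($N\ge 1$) and the weight $\widetilde v$ on $I$ be given by any one of the following three cases: 1. (Generalized Hermite) $I=\mathbb{R}$, $w(z)=|z|^{2\mu}\exp(-|z|^\alpha)$ with $\alpha\ge 1$ and $\mu>-\tfrac12$, $k_N=N^{-1/\alpha}$, $\widetilde v(z)=\exp\left(-\tfrac12|z|^\alpha\right)$. 2. (Laguerre) $I=[0,\infty)$, $w(z)=z^s\exp(-z)$ with $s>-1$, $k_N=N^{-1}$, $\widetilde v(z)=\exp\left(-\tfrac12 z\right)$. 3. (Jacobi) $I=[-1,1]$, $w(z)=(1-z)^\alpha(1+z)^\beta$ with $\alpha,\beta>-1$, $k_N\equiv 1$, $\widetilde v(z)\equiv 1$. Let $(z_n)_{n\ge0}$ be a $w$-weighted Leja sequence on $I$ and set $z_{n,N}=k_N z_n$ for $0\le n\le N$. Then the array $(z_{n,N})$ is asymptotically $\widetilde v$-weighted Fekete, i.e. $$\lim_{N\to\infty}\left[V(z_{0,N},\dots,z_{N,N})\prod_{n=0}^N\widetilde v(z_{n,N})^N\right]^{2/(N^2+N)}=\delta_{\widetilde v},$$ where $\delta_{\widetilde v}$ is the $\widetilde v$-weighted transfinite diameter of $I$.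
   Context: Vandermonde determinant: $V(\xi_0,\dots,\xi_N)=\prod_{0\le j<k\le N}|\xi_j-\xi_k|$ is the modulus of the determinant of the $(N+1)\times(N+1)$ matrix with entries $\xi_j^{k}$, $0\le j,k\le N$. Weighted transfinite diameter: for $N\ge1$, $$\delta^{(N)}_{\widetilde v}=\left[\max_{(\xi_0,\dots,\xi_N)\in I^{N+1}}V(\xi_0,\dots,\xi_N)\prod_{j=0}^N\widetilde v(\xi_j)^N\right]^{2/(N^2+N)},\qquad \delta_{\widetilde v}=\lim_{N\to\infty}\delta^{(N)}_{\widetilde v}$$ (this limit is known to exist and be finite). Weighted Leja sequence: put $v(z)=\sqrt{w(z)}$. A $w$-weighted Leja sequence on $I$ is a sequence $(z_n)_{n\ge0}$ in $I$ where $z_0\in I$ is chosen arbitrarily and, for every $N\ge 0$, $z_{N+1}$ is a maximizer over $z\in I$ of $$F_N(z)=v(z)\prod_{n=0}^N|z-z_n|;$$ if there are several maximizers, one of smallest magnitude $|z|$ is chosen (if maximizers of smallest magnitude differ only in sign, either one may be chosen). When a parameter of $w$ is negative, so that $v$ is singular at a point of $I$, $F_N$ is understood as a $[0,\infty]$-valued function defined at that point by continuous extension, and a point where $F_N=+\infty$ counts as a maximizer. *)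

(* Defs.v *)
From HB Require Import structures.
From mathcomp Require Import all_boot all_order all_algebra.
From mathcomp Require Import all_classical all_reals all_analysis.

Set Implicit Arguments.
Unset Strict Implicit.
Unset Printing Implicit Defensive.

Import Order.TTheory GRing.Theory Num.Theory.
Import numFieldNormedType.Exports.

Local Open Scope classical_set_scope.
Local Open Scope ring_scope.

Definition vandermonde (R : realType) (N : nat) (xi : 'I_N.+1 -> R) : R :=
  \prod_(j < N.+1) \prod_(k < N.+1 | (j < k)%N) `|xi j - xi k|.

Definition weighted_vandermonde (R : realType) (vt : R -> R) (N : nat)
    (xi : 'I_N.+1 -> R) : R :=
  vandermonde xi * \prod_(j < N.+1) vt (xi j) ^+ N.

Definition fekete_exponent (R : realType) (N : nat) : R :=
  2 / (N ^ 2 + N)%:R.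

(* For the pairs (I, vt) under consideration the supremum over I^(N+1) is
   finite and attained, i.e. it is the maximum. *)
Definition transfinite_diameter_at (R : realType) (I : set R) (vt : R -> R)
    (N : nat) : R :=
  sup [set weighted_vandermonde vt xi |
        xi in [set xi : 'I_N.+1 -> R | forall j, I (xi j)]]
  `^ fekete_exponent R N.

Definition transfinite_diameter (R : realType) (I : set R) (vt : R -> R) : R :=
  lim (transfinite_diameter_at I vt N @[N --> \oo]).

(* The rows of the array are indexed by N; row N has N + 1 points. The row
   N = 0 is immaterial, since only the limit is concerned. *)
Definition asymptotically_fekete (R : realType) (I : set R) (vt : R -> R)
    (a : forall N : nat, 'I_N.+1 -> R) : Prop :=
  weighted_vandermonde vt (a N) `^ fekete_exponent R N @[N --> \oo]
    --> transfinite_diameter I vt.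

(* S is the set of points of I at which w is singular; the value of w there is
   irrelevant: the objective is extended to S by continuity along I. *)
Definition leja_objective (R : realType) (I S : set R) (w : R -> R)
    (z : nat -> R) (N : nat) (x : R) : \bar R :=
  let F := fun y : R => Num.sqrt (w y) * \prod_(n < N.+1) `|y - z n| in
  if `[< S x >] then lim ((F y)%:E @[y --> within I x^'])
  else (F x)%:E.

Definition maximizers (R : realType) (I : set R) (F : R -> \bar R) : set R :=
  [set x | I x /\ forall y, I y -> (F y <= F x)%E].

Definition weighted_leja (R : realType) (I S : set R) (w : R -> R)
    (z : nat -> R) : Prop :=
  I (z 0%N) /\
  forall N : nat,
    maximizers I (leja_objective I S w z N) (z N.+1) /\
    forall y, maximizers I (leja_objective I S w z N) y -> `|z N.+1| <= `|y|.

Inductive weight_case (R : realType) : Type :=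
| GenHermite (alpha mu : R)
| Laguerre (s : R)
| Jacobi (alpha beta : R).

Definition admissible (R : realType) (c : weight_case R) : Prop :=
  match c with
  | GenHermite alpha mu => 1 <= alpha /\ - (1 / 2) < mu
  | Laguerre s => -1 < s
  | Jacobi alpha beta => -1 < alpha /\ -1 < beta
  end.

Definition case_interval (R : realType) (c : weight_case R) : set R :=
  match c with
  | GenHermite _ _ => setT
  | Laguerre _ => [set x | 0 <= x]
  | Jacobi _ _ => [set x | -1 <= x <= 1]
  end.

(* Since 0 `^ a = 0 for a < 0, these functions take a junk value at the points
   of case_singular. *)
Definition case_weight (R : realType) (c : weight_case R) (z : R) : R :=
  match c with
  | GenHermite alpha mu => `|z| `^ (2 * mu) * expR (- (`|z| `^ alpha))
  | Laguerre s => z `^ s * expR (- z)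
  | Jacobi alpha beta => (1 - z) `^ alpha * (1 + z) `^ beta
  end.

Definition case_singular (R : realType) (c : weight_case R) : set R :=
  match c with
  | GenHermite _ mu => [set x | x = 0 /\ mu < 0]
  | Laguerre s => [set x | x = 0 /\ s < 0]
  | Jacobi alpha beta =>
      [set x | (x = 1 /\ alpha < 0) \/ (x = -1 /\ beta < 0)]
  end.

Definition case_contraction (R : realType) (c : weight_case R) (N : nat) : R :=
  match c with
  | GenHermite alpha _ => N%:R `^ (- (1 / alpha))
  | Laguerre _ => N%:R^-1
  | Jacobi _ _ => 1
  end.

Definition case_vtilde (R : realType) (c : weight_case R) (z : R) : R :=
  match c with
  | GenHermite alpha _ => expR (- (1 / 2 * `|z| `^ alpha))
  | Laguerre _ => expR (- (1 / 2 * z))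
  | Jacobi _ _ => 1
  end.

(* Main.v *)
Require Import Defs.
From HB Require Import structures.
From mathcomp Require Import all_boot all_order all_algebra.
From mathcomp Require Import all_classical all_reals all_analysis.
From mathcomp Require Import perm ring lra zify.

Set Implicit Arguments.
Unset Strict Implicit.
Unset Printing Implicit Defensive.

Import Order.TTheory GRing.Theory Num.Theory.
Import numFieldNormedType.Exports.

Local Open Scope classical_set_scope.
Local Open Scope ring_scope.

(** Put p_k(x) = prod_(n < k) |x - z_n|, so that the Vandermonde product of
    z_0, ..., z_N is the product of the p_k(z_k), and factor the weight as
    sqrt w = g * u, where u is the exponential factor (1 for Jacobi) and
    g(x) = prod_i |x - a_i|^(sigma_i).  Since vt(k_N x)^N = u(x), dilating N + 1
    points by k_N multiplies all weighted Vandermonde products by one and the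
    same factor.  It is thus enough to compare W_N, the product of
    V(z_0, ..., z_N) and of the u(z_j), with the supremum M_N of the same
    expression over I^(N+1), and to show
      ln M_N - ln W_N = O(N ln N),
    because the exponent 2 / (N^2 + N) turns that into a factor tending to 1.

    Upper bound for M_N.  A Vandermonde determinant may be written in any basis
    of monic polynomials q_k, deg q_k = k; expanding it gives
    M_N <= (N+1)! * prod_k sup_I |q_k| u (vandermonde_le_prod).  If g = 1, then
    q_k = p_k already gives M_N <= (N+1)! * W_N up to a constant, as z_k
    maximizes p_k u.  In general take q_k = prod_i (X - a_i)^m0 * p_(k-m), with
    m0 at least every |sigma_i| and m the degree of the product.  Then |q_k| u
    is p_(k-m) g u times a function of at most polynomial growth, and both the
    points z_k and the places where |q_k| u is large have size O(k^2), by the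
    decay of u.  So
    sup |q_k| u exceeds D_(k-m) by an at most polynomial factor, where D_k is the
    value of p_k g u at its maximizer z_k (node_max_dominates).

    Comparing prod_k D_k with W_N.  Their quotient is, up to constants, the
    product over i of P_i^(sigma_i), with P_i = prod_k |z_k - a_i|.  For
    sigma_i >= 0 the polynomial growth of z_k suffices.  For sigma_i < 0 a lower
    bound of P_i is needed; the size of D_k alone only gives
    |z_k - a_i| >= exp(- O(k ln k)), which is too weak.  But the weight is
    infinite at a_i, so that the Leja rule is forced to choose a_i itself at some
    stage.  Moving this one point to a place at distance at least 1 / (16 (N+2))
    from the other ones shows W_N <= M_N * P_i * exp(O(N ln N))
    (leja_value_le_distance), where P_i omits that point.  With
    r = ln M_N - ln W_N all this adds up to
      r <= (sum_i max(0, - sigma_i)) * r + O(N ln N),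
    and the sum is less than 1 in each of the three cases, by mu > -1/2, s > -1
    and alpha, beta > -1 (configuration_le_leja_value).

    The limit defining the transfinite diameter exists because its terms
    decrease: the N-th power of the weighted Vandermonde product of N + 2 points
    is at most the product of those of its N + 2 subfamilies of N + 1 points
    (weighted_vandermonde_lift). *)

(** * Vandermonde products *)

Section VandermondeProducts.
Variable R : realType.
Implicit Types (n N : nat).

Lemma vandermonde_ge0 N (xi : 'I_N.+1 -> R) : 0 <= vandermonde xi.
Proof. by apply: prodr_ge0 => j _; apply: prodr_ge0 => k _. Qed.

Lemma vandermonde_lift N (xi : 'I_N.+2 -> R) j :
  vandermonde xi =
  (\prod_(k < N.+1) `|xi j - xi (lift j k)|) * vandermonde (xi \o lift j).
Proof.
rewrite /vandermonde (bigD1_ord j)//=.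
under [X in _ * X]eq_bigr => a _.
  rewrite big_mkcond (bigD1_ord j)//=.
  under eq_bigr => b _ do rewrite /bump; over.
rewrite big_split mulrA; congr (_ * _).
  rewrite big_mkcond (bigD1_ord j)//= ltnn mul1r -big_split/=.
  apply: eq_bigr => k _; rewrite /bump.
  case: (leqP j k) => /= jk.
    rewrite ltnS jk; case: ltnP => // kj; last by rewrite mulr1.
    by exfalso; lia.
  rewrite add0n jk; case: ltnP => // kj; last by rewrite mul1r distrC.
  by exfalso; lia.
apply: eq_bigr => a _; rewrite [RHS]big_mkcond; apply: eq_bigr => b _.
suff -> : (lift j a < lift j b)%N = (a < b)%N by [].
by rewrite /= /bump; case: leqP; case: leqP; lia.
Qed.

(** Each unordered pair of indices is met twice, once from either end. *)
Lemma vandermonde_sqr N (xi : 'I_N.+2 -> R) :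
  \prod_j \prod_(k < N.+1) `|xi j - xi (lift j k)| = vandermonde xi ^+ 2.
Proof.
have e j : \prod_(k < N.+1) `|xi j - xi (lift j k)| =
    (\prod_(k < N.+2 | (j < k)%N) `|xi j - xi k|) *
    (\prod_(k < N.+2 | (k < j)%N) `|xi k - xi j|).
  rewrite -[LHS]mul1r.
  have -> : \prod_(k < N.+1) `|xi j - xi (lift j k)| =
      \prod_(k < N.+2 | k != j) `|xi j - xi k|.
    rewrite [RHS]big_mkcond [RHS](bigD1_ord j)//= eqxx mul1r.
    by apply: eq_bigr => k _; rewrite eq_sym neq_lift.
  rewrite mul1r (bigID (fun k : 'I__ => (j < k)%N))/=; congr (_ * _).
    by apply: eq_bigl => k; rewrite -val_eqE/= neq_ltn; case: ltngtP.
  apply: eq_big => [k|k _]; last by rewrite distrC.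
  by rewrite -val_eqE/= neq_ltn; case: ltngtP.
under eq_bigr do rewrite e.
rewrite big_split/= expr2; congr (_ * _).
rewrite /vandermonde (exchange_big_dep xpredT)//=.
Qed.

(** A pair of indices survives exactly the deletions of the other N points;
    the square on the left makes up for the two deletions that destroy it. *)
Lemma prod_vandermonde_lift N (xi : 'I_N.+2 -> R) :
  (\prod_j vandermonde (xi \o lift j)) * vandermonde xi ^+ 2 =
  vandermonde xi ^+ N.+2.
Proof.
rewrite -vandermonde_sqr -big_split/=.
under eq_bigr do rewrite mulrC -vandermonde_lift.
by rewrite prodr_const card_ord.
Qed.

(** Grouping the pairs by their larger index exhibits the quantity that a
    greedy choice of the next point maximizes. *)
Lemma vandermonde_greedy N (z : nat -> R) :
  vandermonde (fun n : 'I_N.+1 => z n) =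
  \prod_(k < N.+1) \prod_(n < k) `|z k - z n|.
Proof.
rewrite /vandermonde (exchange_big_dep xpredT)//=.
apply: eq_bigr => k _; have kN : (k <= N.+1)%N by rewrite ltnW.
rewrite (big_ord_widen _ (fun n : nat => `|z k - z n|) kN).
by apply: eq_bigr => n _; rewrite distrC.
Qed.

(** The passage from the monomial basis to another basis of monic polynomials
    is unitriangular. *)
Lemma det_monic_poly N (q : nat -> {poly R}) (x : 'I_N.+1 -> R) :
  (forall k, q k \is monic) -> (forall k, size (q k) = k.+1) ->
  `|\det (\matrix_(k < N.+1, j < N.+1) (q k).[x j])| = vandermonde x.
Proof.
move=> qm qs.
pose T : 'M[R]_N.+1 := \matrix_(k, i) (q k)`_i.
have -> : \matrix_(k < N.+1, j < N.+1) (q k).[x j] =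
    T *m Vandermonde N.+1 (\row_j x j).
  apply/matrixP => k j; rewrite !mxE (@horner_coef_wide _ N.+1) ?qs//.
  by apply: eq_bigr => i _; rewrite !mxE.
rewrite det_mulmx det_trig; last first.
  by apply/is_trig_mxP => k i ki; rewrite mxE nth_default// qs.
rewrite big1 ?mul1r; last first.
  by move=> k _; rewrite mxE; move/monicP: (qm k); rewrite lead_coefE qs.
rewrite det_Vandermonde normr_prod; apply: eq_bigr => i _.
by rewrite normr_prod; apply: eq_bigr => j _; rewrite !mxE distrC.
Qed.

(** Leibniz expansion of the determinant in the basis q, each of its (N+1)!
    terms being bounded factor by factor. *)
Lemma vandermonde_le_prod N (q : nat -> {poly R}) (u : R -> R) (t : nat -> R)
    (x : 'I_N.+1 -> R) :
  (forall k, q k \is monic) -> (forall k, size (q k) = k.+1) ->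
  (forall j, 0 <= u (x j)) ->
  (forall (k : nat) j, `|(q k).[x j]| * u (x j) <= t k) ->
  vandermonde x * \prod_j u (x j) <= (N.+1)`!%:R * \prod_(k < N.+1) t k.
Proof.
move=> qm qs u0 qt; rewrite -(det_monic_poly x qm qs).
have P0 : 0 <= \prod_j u (x j) by apply: prodr_ge0 => i _; exact: u0.
rewrite -{1}(ger0_norm P0).
rewrite -normrM /determinant mulr_suml.
apply: (le_trans (ler_norm_sum _ _ _)).
have -> : (N.+1)`!%:R * \prod_(k < N.+1) t k =
    \sum_(p : {perm 'I_N.+1}) \prod_(k < N.+1) t k.
  by rewrite sumr_const card_Sn mulr_natl.
apply: ler_sum => p _; rewrite !normrM normrX normrN1 expr1n mul1r.
rewrite [X in _ * `|X|](reindex_inj (@perm_inj _ p))/= !normr_prod -big_split/=.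
apply: ler_prod => k _; rewrite mxE mulr_ge0//= (ger0_norm (u0 _)).
exact: qt.
Qed.

End VandermondeProducts.

(** * Existence of the transfinite diameter *)

Section TransfiniteDiameter.
Variables (R : realType) (I : set R) (vt : R -> R).
Hypothesis vt_gt0 : forall x, I x -> 0 < vt x.
Hypothesis I_neq0 : I !=set0.

Definition vandermonde_values N : set R :=
  [set weighted_vandermonde vt xi |
    xi in [set xi : 'I_N.+1 -> R | forall j, I (xi j)]].

Hypothesis vandermonde_bounded :
  forall N, (0 < N)%N -> has_ubound (vandermonde_values N).

Lemma weighted_vandermonde_ge0 N (xi : 'I_N.+1 -> R) :
  (forall j, I (xi j)) -> 0 <= weighted_vandermonde vt xi.
Proof.
move=> Ixi; rewrite mulr_ge0 ?vandermonde_ge0//.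
by apply: prodr_ge0 => j _; rewrite exprn_ge0// ltW ?vt_gt0.
Qed.

Lemma has_sup_vandermonde N : (0 < N)%N -> has_sup (vandermonde_values N).
Proof.
move=> N0; split; last exact: vandermonde_bounded.
have [x Ix] := I_neq0.
by exists (weighted_vandermonde vt (fun _ : 'I_N.+1 => x)), (fun=> x).
Qed.

(** Each pair of points survives N of the N + 2 deletions, and each weight
    survives N + 1 of them with exponent N, hence with total exponent N (N + 1),
    which is the exponent it has in the N-th power on the left. *)
Lemma weighted_vandermonde_lift N (xi : 'I_N.+2 -> R) :
  (0 < N)%N -> (forall j, I (xi j)) ->
  weighted_vandermonde vt xi ^+ N <=
  \prod_j weighted_vandermonde vt (xi \o lift j).
Proof.
move=> N0 Ixi; pose P := \prod_(j < N.+2) vt (xi j).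
have P0 : 0 < P by apply: prodr_gt0 => j _; exact: vt_gt0.
have PE : (\prod_(j < N.+2) \prod_(k < N.+1) vt (xi (lift j k))) = P ^+ N.+1.
  apply: (mulfI (lt0r_neq0 P0)); rewrite -exprS {1}/P -big_split/=.
  under eq_bigr => j _.
    rewrite (_ : _ * _ = P); last by rewrite /P [RHS](bigD1_ord j).
    over.
  by rewrite prodr_const card_ord.
have [V0|V0] := eqVneq (vandermonde xi) 0.
  rewrite {1}/weighted_vandermonde V0 mul0r expr0n -[N == 0%N]negbK -lt0n N0/=.
  by apply: prodr_ge0 => j _; apply: weighted_vandermonde_ge0 => k; exact: Ixi.
rewrite le_eqVlt; apply/orP; left; apply/eqP.
rewrite /weighted_vandermonde big_split/=.
under [X in _ = _ * X]eq_bigr do rewrite prodrXl.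
rewrite !prodrXl PE exprMn -!exprM mulnC; congr (_ * _).
apply: (mulIf (expf_neq0 2 V0)).
by rewrite prod_vandermonde_lift -exprD addn2.
Qed.

(** Taking suprema in weighted_vandermonde_lift bounds the N-th power of the
    supremum of order N + 1 by the (N+2)-nd power of that of order N; raise this
    to the power 2 / (N (N + 1) (N + 2)). *)
Lemma transfinite_diameter_at_le N : (0 < N)%N ->
  transfinite_diameter_at I vt N.+1 <= transfinite_diameter_at I vt N.
Proof.
move=> N0; rewrite /transfinite_diameter_at -!/(vandermonde_values _).
set X := sup _; set Y := sup _.
have Nr : 0 < N%:R :> R by rewrite ltr0n.
have X0 : 0 <= X.
  have [x Ix] := I_neq0.
  apply: (@le_trans _ _ (weighted_vandermonde vt (fun _ : 'I_N.+2 => x))).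
    exact: weighted_vandermonde_ge0.
  by apply: ub_le_sup; [exact: vandermonde_bounded|exists (fun=> x)].
have Y0 : 0 <= Y.
  have [x Ix] := I_neq0.
  apply: (@le_trans _ _ (weighted_vandermonde vt (fun _ : 'I_N.+1 => x))).
    exact: weighted_vandermonde_ge0.
  by apply: ub_le_sup; [exact: vandermonde_bounded|exists (fun=> x)].
have XY : X ^+ N <= Y ^+ N.+2.
  have -> : Y ^+ N.+2 = ((Y ^+ N.+2) `^ N%:R^-1) ^+ N.
    rewrite -powR_mulrn ?powR_ge0// -powRrM mulVf ?gt_eqF// powRr1//.
    exact: exprn_ge0.
  rewrite lerXn2r ?nnegrE ?powR_ge0//.
  apply: ge_sup; first by case: (@has_sup_vandermonde N.+1).
  move=> _ [xi Ixi <-].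
  have w0 := weighted_vandermonde_ge0 Ixi.
  rewrite -(@ler_pXn2r _ N)// ?nnegrE ?powR_ge0//.
  rewrite -[leRHS]powR_mulrn ?powR_ge0// -powRrM mulVf ?gt_eqF//.
  rewrite powRr1 ?exprn_ge0//.
  apply: (le_trans (weighted_vandermonde_lift N0 Ixi)).
  rewrite -[in leRHS](card_ord N.+2) -prodr_const.
  apply: ler_prod => j _.
  rewrite weighted_vandermonde_ge0 => [/=|k]; last exact: Ixi.
  apply: ub_le_sup; first exact: vandermonde_bounded.
  by exists (xi \o lift j) => // k; exact: Ixi.
pose e : R := 2 / (N%:R * N.+1%:R * N.+2%:R).
have -> : fekete_exponent R N.+1 = N%:R * e.
  rewrite /fekete_exponent /e natrD natrX -!natr1; field.
  by rewrite !natr1 !pnatr_eq0/= -natrX -natrD pnatr_eq0; lia.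
have -> : fekete_exponent R N = N.+2%:R * e.
  rewrite /fekete_exponent /e natrD natrX -!natr1; field.
  by rewrite !natr1 !pnatr_eq0/= -natrX -natrD pnatr_eq0; lia.
have : 0 <= e by rewrite /e divr_ge0// !mulr_ge0.
move: e => e e0; rewrite !powRrM !powR_mulrn//.
by apply: ge0_ler_powR; rewrite ?nnegrE ?exprn_ge0.
Qed.

Lemma is_cvg_transfinite_diameter :
  cvgn (transfinite_diameter_at I vt).
Proof.
apply: (@near_nonincreasing_is_cvgn _ _ 0).
  near=> m => n mn.
  elim: n mn => [|n IH]; first by rewrite leqn0 => /eqP ->.
  rewrite leq_eqVlt ltnS => /predU1P[->//|mn].
  apply: le_trans (IH mn); apply: transfinite_diameter_at_le.
  by apply: leq_trans mn; near: m; exact: nbhs_infty_gt.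
by near=> n; exact: powR_ge0.
Unshelve. all: by end_near.
Qed.

End TransfiniteDiameter.

(** * Elementary estimates *)

Section Estimates.
Variable R : realType.
Implicit Types (y t : R) (k m n : nat).

Lemma bounded_expM_expRN n :
  exists2 B : R, 1 <= B & forall y, 1 <= y -> y ^+ n * expR (- (y / 2)) <= B.
Proof.
exists (2 ^+ n.+1 * (n.+1)`!%:R).
  by rewrite mulr_ege1 ?exprn_ege1 ?ler1n ?fact_gt0// ler1n.
move=> y y1; have y0 : 0 <= y by lra.
rewrite expRN ler_pdivrMr ?expR_gt0//.
apply: (@le_trans _ _ (y ^+ n.+1)); first by rewrite ler_weXn2l.
have := @expR_ge1Dxn R (y / 2) n (divr_ge0 y0 (ler0n _ 2)).
rewrite expr_div_n => h.
have f0 : 0 < (n.+1)`!%:R :> R by rewrite ltr0n fact_gt0.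
have {h}: y ^+ n.+1 / 2 ^+ n.+1 / (n.+1)`!%:R <= expR (y / 2) by lra.
by rewrite ler_pdivrMr// ler_pdivrMr ?exprn_gt0// -mulrA mulrC [_%:R * _]mulrC.
Qed.

Lemma ln_le_sqrt y : 0 < y -> ln y <= 2 * Num.sqrt y.
Proof.
move=> y0; have s0 : 0 < Num.sqrt y by rewrite sqrtr_gt0.
rewrite -{1}(sqr_sqrtr (ltW y0)) lnXn// -[ln _ *+ _]mulr_natl ler_pM2l//.
exact/ltW/ln_sublinear.
Qed.

Lemma ln_prod (T : finType) (F : T -> R) :
  (forall i, 0 < F i) -> ln (\prod_i F i) = \sum_i ln (F i).
Proof.
move=> F0; suff [] : 0 < \prod_i F i /\ ln (\prod_i F i) = \sum_i ln (F i) by [].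
apply: (big_ind2 (fun x y => 0 < x /\ ln x = y)) => [|x y x' y' [x0 <-] [y0 <-]|//].
  by rewrite ltr01 ln1.
by rewrite mulr_gt0// lnM.
Qed.

(** The right-hand side is of size exp(- O(k ln k)), the left-hand side at most
    exp(O(k ln y) - y / 2): a threshold of order k^2 is enough, since
    ln y = O(sqrt y). *)
Lemma exp_decay_tail m (eps : R) : 0 < eps ->
  exists2 A : R, 1 <= A & forall k y, A * k.+1%:R ^+ 2 < y ->
    y ^+ (k + m) * expR (- (y / 2)) < eps * (16 * k.+1%:R) ^- k.
Proof.
move=> e0; pose E := `|ln eps|.
have E0 : 0 <= E by exact: normr_ge0.
(* with t = sqrt y > B K, each of (k + m) ln y, k ln (16 K) and E is at most a
   multiple of t^2 / B, and c collects the three multiples *)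
pose c : R := 2 * m.+1%:R + 16 + E.
have m0 : 0 <= m.+1%:R :> R by [].
have c16 : 16 <= c by rewrite /c; lra.
pose B := 2 * c + 1.
have B1 : 1 <= B by rewrite /B; lra.
exists (B ^+ 2); first exact: exprn_ege1.
move=> k y; set K : R := k.+1%:R => yB.
have K1 : 1 <= K by rewrite ler1n.
have y0 : 0 < y by apply: le_lt_trans yB; rewrite mulr_ge0 ?exprn_ge0//; lra.
pose t := Num.sqrt y.
have ty : t ^+ 2 = y by rewrite sqr_sqrtr// ltW.
have t0 : 0 < t by rewrite sqrtr_gt0.
have tB : B * K < t.
  by rewrite -(@ltr_pXn2r _ 2)// ?nnegrE ?ty ?exprMn//; nra.
have K16 : 0 < 16 * K by lra.
rewrite -ltr_ln ?posrE ?mulr_gt0 ?exprn_gt0 ?expR_gt0 ?invr_gt0 ?exprn_gt0//.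
rewrite !lnM ?posrE ?exprn_gt0 ?expR_gt0 ?invr_gt0 ?exprn_gt0//.
rewrite expRK lnV ?posrE ?exprn_gt0// !lnXn//.
rewrite -[ln y *+ _]mulr_natl -[ln (_ * _) *+ _]mulr_natl.
have h1 : (k + m)%:R * ln y <= (m.+1%:R * K) * (2 * t).
  apply: (@le_trans _ _ ((k + m)%:R * (2 * t))).
    by rewrite ler_wpM2l// ln_le_sqrt.
  rewrite ler_pM2r ?mulr_gt0// /K -natrM ler_nat; lia.
have h2 : k%:R * ln (16 * K) <= K * (16 * K).
  apply: (@le_trans _ _ (k%:R * (16 * K))).
    by rewrite ler_wpM2l//; exact/ltW/ln_sublinear.
  by rewrite ler_pM2r// ler_nat.
have h3 : - E <= ln eps by rewrite lerNnormlW.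
have h4 : B * ((m.+1%:R * K) * (2 * t)) <= 2 * m.+1%:R * t ^+ 2.
  have := ler_wpM2l m0 (ltW tB); nra.
have h5 : B * (K * (16 * K)) <= 16 * t ^+ 2.
  have : B * K <= t by exact: ltW.
  nra.
have h6 : B * E <= E * t ^+ 2.
  have : B <= t ^+ 2 by nra.
  by move=> ?; rewrite mulrC ler_wpM2l.
have h7 : B * ((k + m)%:R * ln y + k%:R * ln (16 * K) + E) <= c * t ^+ 2.
  have B0 : 0 <= B by lra.
  have := ler_wpM2l B0 h1; have := ler_wpM2l B0 h2.
  rewrite /c; lra.
have h8 : c * t ^+ 2 < B * (t ^+ 2 / 2).
  have : 0 < t ^+ 2 by rewrite exprn_gt0.
  by rewrite /B; nra.
have : (k + m)%:R * ln y + k%:R * ln (16 * K) + E < t ^+ 2 / 2.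
  by have := le_lt_trans h7 h8; rewrite ltr_pM2l//; lra.
rewrite ty; lra.
Qed.

(** Among k + 1 equally spaced candidates in [1/4, 1/2], each of the k given
    points is close to at most one.  Distances are measured relative to
    1 + |w n| because the product of these factors is what bounds the node
    polynomial from above. *)
Lemma exists_separated k (w : nat -> R) :
  exists2 y, 1 / 4 <= y <= 1 / 2 &
    forall n, (n < k)%N -> (1 + `|w n|) / (16 * k.+1%:R) <= `|y - w n|.
Proof.
pose K : R := k.+1%:R; have K1 : 1 <= K by rewrite ler1n.
have K0 : K != 0 by rewrite gt_eqF//; lra.
pose y (j : 'I_k.+1) : R := 1 / 4 + j%:R / (4 * K).
have [[j jw]|bad] := pselect (exists j, forall n, (n < k)%N ->
    1 / (8 * K) <= `|y j - w n|).
  have yj2 : 1 / 4 <= y j <= 1 / 2.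
    have j0 : 0 <= j%:R / (4 * K) by rewrite divr_ge0//; lra.
    have : j%:R / (4 * K) <= 1 / 4.
      rewrite ler_pdivrMr; last lra.
      have : j%:R <= K by rewrite ler_nat ltnW.
      lra.
    by rewrite /y; move: j0; move: (_ / _) => q; lra.
  exists (y j) => // n /jw; rewrite ler_pdivrMr; last lra.
  rewrite ler_pdivrMr; last lra.
  have yj : `|y j| <= 1 / 2 by rewrite ger0_norm; lra.
  have := ler_normB (y j) (y j - w n); rewrite subKr.
  set d := `|y j - w n| => wd dK.
  have : d <= d * K by rewrite ler_peMr// normr_ge0.
  lra.
exfalso.
have /choice[n nP] : forall j, exists n : 'I_k, `|y j - w n| < 1 / (8 * K).
  move=> j; apply: contrapT => h; apply: bad; exists j => n nk.
  by rewrite leNgt; apply/negP => h'; apply: h; exists (Ordinal nk).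
have : ~ injective n by move=> /leq_card; rewrite !card_ord ltnn.
apply => i j nij; apply/val_inj/eqP; rewrite /=.
apply/negPn/negP => ij.
have hi := nP i; have := nP j; rewrite -nij => hj.
have : `|y i - y j| < 1 / (4 * K).
  have -> : y i - y j = (y i - w (n i)) - (y j - w (n i)) by ring.
  apply: le_lt_trans (ler_normB _ _) _.
  have -> : 1 / (4 * K) = 1 / (8 * K) + 1 / (8 * K) by field.
  exact: ltrD.
have -> : y i - y j = (i%:R - j%:R) / (4 * K) by rewrite /y; field.
have K4 : 0 < 4 * K by lra.
rewrite normrM normfV (gtr0_norm K4) ltr_pM2r ?invr_gt0//.
move: ij; case: ltngtP => // ij _; apply/negP; rewrite -leNgt.
  rewrite distrC ger0_norm ?subr_ge0 ?ler_nat 1?ltnW//.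
  by rewrite lerBrDl natr1 ler_nat.
rewrite ger0_norm ?subr_ge0 ?ler_nat 1?ltnW//.
by rewrite lerBrDl natr1 ler_nat.
Qed.

Lemma powR_lower t (s : R) : 4^-1 <= t <= 4 -> 4 `^ (- `|s|) <= t `^ s.
Proof.
move=> /andP[t1 t4]; have t0 : 0 < t by lra.
rewrite -ler_ln ?posrE ?powR_gt0// !ln_powR mulNr lerNl.
apply: (le_trans (ler_norm _)); rewrite normrN normrM ler_wpM2l//.
rewrite ler_norml -lnV ?posrE// !ler_ln ?posrE//; lra.
Qed.

Lemma powR_le_expn t y (s : R) n : `|s| <= n%:R -> 1 <= t <= y ->
  t `^ s <= y ^+ n.
Proof.
move=> sn /andP[t1 ty].
apply: (@le_trans _ _ (t `^ n%:R)).
  by rewrite ler_powR// (le_trans (ler_norm _)).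
by rewrite powR_mulrn ?lerXn2r ?nnegrE//; lra.
Qed.

Lemma expn_le_powR t y (s : R) n : `|s| <= n%:R -> 0 < t <= y -> 1 <= y ->
  t ^+ n <= y ^+ (2 * n) * t `^ s.
Proof.
move=> sn /andP[t0 ty] y1; have := sn; rewrite ler_norml => /andP[sn1 sn2].
have -> : t ^+ n = t `^ (n%:R - s) * t `^ s.
  by rewrite -powRD ?(gt_eqF t0) ?implybT// subrK powR_mulrn ?ltW.
rewrite ler_wpM2r ?powR_ge0//.
apply: (@le_trans _ _ (y `^ (n%:R - s))).
  by apply: ge0_ler_powR; rewrite ?nnegrE; lra.
rewrite -powR_mulrn; last by lra.
by rewrite ler_powR// natrM; lra.
Qed.

End Estimates.

(** * Near-optimality of greedy sequences *)

Section LejaGrowth.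
Variables (R : realType) (J : finType) (I : set R) (u : R -> R).
Variables (a sigma : J -> R) (z : nat -> R) (K0 : nat) (cu Cu : R).

Definition singular_factor (x : R) : R := \prod_(i : J) `|x - a i| `^ sigma i.
Local Notation g := singular_factor.

Definition node_product k (x : R) : R := \prod_(n < k) `|x - z n|.
Local Notation p := node_product.

Hypothesis I_sub : forall y, 1 / 4 <= y <= 1 / 2 -> I y.
Hypothesis a_le1 : forall i, `|a i| <= 1.
(* [1/4, 1/2] is a place common to the three intervals, away from the points
   0, 1 and -1 where the weights vanish or are singular; test points are taken
   there *)
Hypothesis a_far : forall i y, 1 / 4 <= y <= 1 / 2 -> 1 / 4 <= `|y - a i|.
Hypothesis cu_gt0 : 0 < cu.
Hypothesis u_gt0 : forall x, I x -> 0 < u x.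
Hypothesis u_lower : forall x, I x -> `|x| <= 2 -> cu <= u x.
Hypothesis u_upper : forall x, I x -> u x <= Cu * expR (- (`|x| / 2)).
Hypothesis z_I : forall n, I (z n).
Hypothesis z_new : forall k, 0 < p k (z k).
(* the greedy rule is assumed only from the rank K0 on: the point z 0 is
   arbitrary, and the early points may be forced to be singular points of the
   weight, where the extended objective is infinite *)
Hypothesis z_max : forall k y, (K0 <= k)%N -> I y ->
  p k y * (g y * u y) <= p k (z k) * (g (z k) * u (z k)).

Definition node_max k : R := p k (z k) * (g (z k) * u (z k)).
Local Notation D := node_max.

(** The common scale of the upper and lower bounds for the node polynomial; it
    cancels when they are compared, so that no prior bound on the points z n is
    required. *)
Definition node_scale k : R := \prod_(n < k) (1 + `|z n|).
Local Notation Z := node_scale.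

Let K16 k : 0 < 16 * k.+1%:R :> R. Proof. by rewrite mulr_gt0. Qed.

Lemma node_scale_ge1 k : 1 <= Z k.
Proof.
apply: (big_ind (fun x => 1 <= x)) => // [x y|n _]; last by rewrite lerDl.
exact: mulr_ege1.
Qed.

Lemma node_product_ge0 k x : 0 <= p k x.
Proof. exact: prodr_ge0. Qed.

Lemma node_product_le k x : p k x <= (1 + `|x|) ^+ k * Z k.
Proof.
have -> : (1 + `|x|) ^+ k = \prod_(n < k) (1 + `|x|).
  by rewrite prodr_const card_ord.
rewrite -big_split/=; apply: ler_prod => n _; rewrite normr_ge0/=.
apply: le_trans (ler_normB _ _) _.
have := normr_ge0 x; have := normr_ge0 (z n); nra.
Qed.

Lemma node_product_separated k : exists2 y, 1 / 4 <= y <= 1 / 2 &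
  (16 * k.+1%:R) ^- k * Z k <= p k y.
Proof.
have [y y12 yz] := exists_separated k z; exists y => //.
have -> : (16 * k.+1%:R) ^- k = \prod_(n < k) (16 * k.+1%:R)^-1 :> R.
  by rewrite prodr_const card_ord exprVn.
rewrite -big_split/=.
apply: ler_prod => n _; rewrite mulr_ge0 ?addr_ge0 ?invr_ge0 ?(ltW (K16 k))//=.
by rewrite mulrC yz.
Qed.

Lemma singular_factor_lower :
  exists2 c : R, 0 < c & forall y, 1 / 4 <= y <= 1 / 2 -> c <= g y.
Proof.
exists (\prod_(i : J) 4 `^ (- `|sigma i|)).
  by apply: prodr_gt0 => i _; apply: powR_gt0.
move=> y y12; apply: ler_prod => i _; rewrite powR_ge0/= powR_lower//.
have := a_far i y12; have := a_le1 i; have := ler_normB y (a i).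
have : `|y| <= 1 / 2 by rewrite ger0_norm; lra.
lra.
Qed.

Lemma node_max_lower : exists2 c : R, 0 < c & forall k, (K0 <= k)%N ->
  c * (16 * k.+1%:R) ^- k * Z k <= D k.
Proof.
have [c c0 cP] := singular_factor_lower.
exists (c * cu) => [|k Kk]; first exact: mulr_gt0.
have [y y12 yP] := node_product_separated k.
apply: le_trans (z_max Kk (I_sub y12)).
rewrite -mulrA mulrC; apply: ler_pM => //.
- rewrite mulr_ge0 ?invr_ge0 ?exprn_ge0 ?(ltW (K16 _))//.
  exact: le_trans (node_scale_ge1 k).
- by rewrite mulr_ge0 ?ltW.
apply: ler_pM; rewrite ?(ltW c0) ?(ltW cu_gt0) ?cP//.
by apply: u_lower; [exact: I_sub|rewrite ger0_norm; lra].
Qed.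

Lemma exponent_bound : exists2 m0 : nat, (0 < m0)%N &
  forall i, `|sigma i| <= m0%:R.
Proof.
exists (Num.truncn (\sum_i `|sigma i|)).+1 => // i.
apply/ltW/(le_lt_trans _ (truncnS_gt _)).
by rewrite (bigD1 i)//= lerDl sumr_ge0.
Qed.

Section FixedExponent.
Variable m0 : nat.
Hypothesis m0_gt0 : (0 < m0)%N.
Hypothesis sigma_le : forall i, `|sigma i| <= m0%:R.
Let m := (m0 * #|J|)%N.

Let expr_m (y : R) : y ^+ m = \prod_(i : J) y ^+ m0.
Proof. by rewrite prodr_const -exprM. Qed.

Let norm_sub_le x i : `|x - a i| <= 1 + `|x|.
Proof. by have := ler_normB x (a i); have := a_le1 i; lra. Qed.

(** Far out, the decay of u beats the growth of the polynomials by more than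
    the factor (16 (k + 1))^k lost at a separated test point. *)
Lemma node_max_tail : exists2 A : R, 3 <= A & forall k x, (K0 <= k)%N -> I x ->
  A * k.+1%:R ^+ 2 < 1 + `|x| -> (1 + `|x|) ^+ m * (p k x * u x) < D k.
Proof.
have [c c0 cP] := node_max_lower.
have Cu0 : 0 < Cu.
  have : 0 < Cu * expR (- (`|1 / 4| / 2)).
    have I4 : I (1 / 4) by apply: I_sub; lra.
    exact: lt_le_trans (u_gt0 I4) (u_upper I4).
  by rewrite pmulr_lgt0 ?expR_gt0.
pose C := Cu * expR (1 / 2); have C0 : 0 < C by rewrite mulr_gt0 ?expR_gt0.
have [A A1 AP] := exp_decay_tail m (divr_gt0 c0 C0).
exists (A + 2) => [|k x Kk Ix xA]; first by lra.
set y := 1 + `|x|; have y0 : 0 <= y by rewrite addr_ge0.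
have uxy : u x <= C * expR (- (y / 2)).
  apply: le_trans (u_upper Ix) _; rewrite /C -mulrA -expRD.
  by rewrite (_ : 1 / 2 + _ = - (`|x| / 2))// /y; field.
apply: lt_le_trans (cP k Kk).
have Z0 : 0 < Z k := lt_le_trans ltr01 (node_scale_ge1 k).
have p0 := node_product_ge0 k x.
have -> : c * (16 * k.+1%:R) ^- k * Z k =
    C * (c / C * (16 * k.+1%:R) ^- k) * Z k by field; rewrite ?gt_eqF.
apply: (@le_lt_trans _ _ (C * (y ^+ (k + m) * expR (- (y / 2))) * Z k)).
  have := ler_pM p0 (ltW (u_gt0 Ix)) (node_product_le k x) uxy.
  move=> /(ler_wpM2l (exprn_ge0 m y0)); rewrite exprD -/y.
  move/le_trans; apply; rewrite le_eqVlt; apply/orP; left; apply/eqP; ring.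
rewrite ltr_pM2r// ltr_pM2l//; apply: AP; apply: le_lt_trans xA.
by rewrite ler_wpM2r ?exprn_ge0//; lra.
Qed.

Lemma node_max_gt0 k : (K0 <= k)%N -> 0 < D k.
Proof.
move=> Kk; have [c c0 cP] := node_max_lower; apply: lt_le_trans (cP k Kk).
rewrite !mulr_gt0 ?invr_gt0 ?exprn_gt0//.
exact: lt_le_trans (node_scale_ge1 k).
Qed.

Let A_square (A : R) k : 3 <= A -> 1 <= A * k.+1%:R ^+ 2.
Proof.
move=> A3; have : 1 <= k.+1%:R ^+ 2 :> R by rewrite exprn_ege1// ler1n.
nra.
Qed.

(** Multiplying by |x - a_i|^m0 absorbs the factor |x - a_i|^(sigma_i) of
    either sign: the quotient |x - a_i|^(m0 - sigma_i) has a nonnegative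
    exponent and grows polynomially; the tail estimate confines everything to
    |x| = O(k^2). *)
Lemma node_max_dominates : exists2 A : R, 3 <= A &
  (forall k, (K0 <= k)%N -> 1 + `|z k| <= A * k.+1%:R ^+ 2) /\
  forall k x, (K0 <= k)%N -> I x ->
   (\prod_i `|x - a i| ^+ m0) * p k x * u x <=
     (A * k.+1%:R ^+ 2) ^+ (2 * m) * D k.
Proof.
have [A A3 AP] := node_max_tail; exists A => //; split=> [k Kk|k x Kk Ix].
  rewrite leNgt; apply/negP => zA; have := AP _ _ Kk (z_I k) zA.
  apply/negP; rewrite -leNgt /D mulrCA ler_wpM2r//.
    by rewrite mulr_ge0 ?node_product_ge0// ltW ?u_gt0.
  have z2 : 2 < `|z k|.
    have : 1 <= k.+1%:R ^+ 2 :> R by rewrite exprn_ege1// ler1n.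
    nra.
  rewrite expr_m.
  apply: ler_prod => i _; rewrite powR_ge0/= powR_le_expn// norm_sub_le.
  by have := lerB_normD (z k) (- a i); rewrite normrN; have := a_le1 i; lra.
have y1 : 1 <= 1 + `|x| by rewrite lerDl.
have D0 := node_max_gt0 Kk; have u0 := u_gt0 Ix.
have AK := A_square k A3.
have [xA|xA] := leP (1 + `|x|) (A * k.+1%:R ^+ 2); last first.
  apply: (@le_trans _ _ (D k)); last first.
    by rewrite ler_peMl ?exprn_ege1// ltW.
  apply/ltW/(le_lt_trans _ (AP _ _ Kk Ix xA)); rewrite -mulrA ler_wpM2r//.
    by rewrite mulr_ge0 ?node_product_ge0// ltW.
  rewrite expr_m; apply: ler_prod => i _.
  by rewrite exprn_ge0//= lerXn2r ?nnegrE// (le_trans ler01).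
(* at x = a i the left-hand side vanishes, whereas p g u may be meaningless *)
have [/existsP[i /eqP xi]|/existsPn xa] := boolP [exists i, x == a i].
  rewrite (bigD1 i)//= xi subrr normr0 expr0n gtn_eqF// !mul0r.
  by rewrite mulr_ge0 ?exprn_ge0 ?(ltW D0) ?(le_trans ler01 AK).
apply: (@le_trans _ _ ((1 + `|x|) ^+ (2 * m) * D k)); last first.
  by rewrite ler_pM2r// lerXn2r ?nnegrE ?(le_trans ler01 y1) ?(le_trans ler01 AK).
apply: (@le_trans _ _ ((1 + `|x|) ^+ (2 * m) * (p k x * (g x * u x)))); last first.
  by rewrite ler_wpM2l ?z_max// exprn_ge0// (le_trans ler01 y1).
have -> : (1 + `|x|) ^+ (2 * m) * (p k x * (g x * u x)) =
    ((1 + `|x|) ^+ (2 * m) * g x) * (p k x * u x) by ring.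
rewrite -mulrA ler_wpM2r//.
  by rewrite mulr_ge0 ?node_product_ge0// ltW.
have -> : (1 + `|x|) ^+ (2 * m) = \prod_(i : J) (1 + `|x|) ^+ (2 * m0).
  by rewrite prodr_const -exprM mulnA.
rewrite -big_split/=.
apply: ler_prod => i _; rewrite exprn_ge0//= expn_le_powR//.
by rewrite norm_sub_le normr_gt0 subr_eq0 xa.
Qed.

Definition upper_factor (A C : R) k : R :=
  if (k < m + K0)%N then C
  else (A * (k - m).+1%:R ^+ 2) ^+ (2 * m) * D (k - m).

(** The monic polynomials entering the determinant bound; the powers of 'X only
    fill the finitely many degrees for which the greedy rule says nothing. *)
Definition comparison_poly k : {poly R} :=
  if (k < m + K0)%N then 'X^k
  else (\prod_i ('X - (a i)%:P) ^+ m0) * \prod_(n < k - m) ('X - (z n)%:P).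

Lemma comparison_poly_monic k :
  comparison_poly k \is monic /\ size (comparison_poly k) = k.+1.
Proof.
rewrite /comparison_poly; case: ltnP => [_|km].
  by rewrite monicXn size_polyXn.
have h1 : (\prod_i ('X - (a i)%:P) ^+ m0 \is monic) /\
    size (\prod_i ('X - (a i)%:P) ^+ m0) = m.+1.
  have -> : m = (\sum_(i : J) m0)%N by rewrite sum_nat_const mulnC.
  apply: (big_ind2 (fun (P : {poly R}) d => P \is monic /\ size P = d.+1)).
  - by rewrite monic1 size_poly1.
  - move=> P d Q e [Pm Pd] [Qm Qe]; rewrite monicMl//.
    by rewrite size_monicM ?monic_neq0// Pd Qe addSn addnS.
  - by move=> i _; rewrite monic_exp ?monicXsubC// size_exp_XsubC.
have h2 : (\prod_(n < k - m) ('X - (z n)%:P)) \is monic /\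
    size (\prod_(n < k - m) ('X - (z n)%:P)) = (k - m).+1.
  by rewrite monic_prod_XsubC size_prod_XsubC /index_enum -enumT size_enum_ord.
case: h1 => am as_; case: h2 => zm zs; rewrite monicMl//.
split=> //; rewrite size_monicM ?monic_neq0// as_ zs addSn addnS/=.
by rewrite subnKC// (leq_trans _ km)// leq_addr.
Qed.

Lemma configuration_le_prod : exists A C : R, [/\ 3 <= A, 1 <= C,
  forall k, (K0 <= k)%N -> 1 + `|z k| <= A * k.+1%:R ^+ 2 &
  forall N (x : 'I_N.+1 -> R), (forall j, I (x j)) ->
    vandermonde x * \prod_j u (x j) <=
    (N.+1)`!%:R * \prod_(k < N.+1) upper_factor A C k].
Proof.
have [A A3 [zA AP]] := node_max_dominates.
have [B B1 BP] := bounded_expM_expRN R (m + K0).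
exists A, (1 + `|Cu| * expR (1 / 2) * B); split => //.
  by rewrite lerDl !mulr_ge0 ?expR_ge0//; lra.
move=> N x Ix; apply: (vandermonde_le_prod (q := comparison_poly)).
- by move=> k; case: (comparison_poly_monic k).
- by move=> k; case: (comparison_poly_monic k).
- by move=> j; rewrite ltW ?u_gt0.
move=> k j; move: (Ix j); move: (x j) => {x Ix}x Ix.
rewrite /upper_factor /comparison_poly; case: ltnP => [km|km].
  set y := 1 + `|x|; have y1 : 1 <= y by rewrite lerDl.
  have uxy : u x <= `|Cu| * expR (1 / 2) * expR (- (y / 2)).
    apply: le_trans (u_upper Ix) _; rewrite -mulrA -expRD.
    rewrite (_ : 1 / 2 + _ = - (`|x| / 2)); last by rewrite /y; field.
    by rewrite ler_wpM2r ?expR_ge0// ler_norm.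
  have xy : `|x| ^+ k <= y ^+ (m + K0).
    apply: (@le_trans _ _ (y ^+ k)); last by rewrite ler_weXn2l// ltnW.
    by rewrite lerXn2r ?nnegrE// /y; have := normr_ge0 x; lra.
  rewrite hornerXn normrX.
  apply: le_trans (ler_pM _ _ xy uxy) _ => //; first by rewrite ltW ?u_gt0.
  rewrite mulrCA; have := BP y y1; set e := _ * expR (- _) => eB.
  apply: (@le_trans _ _ (`|Cu| * expR (1 / 2) * B)); last by rewrite lerDr.
  by rewrite ler_wpM2l// mulr_ge0 ?expR_ge0.
rewrite hornerM normrM !horner_prod !normr_prod.
under eq_bigr do rewrite horner_exp hornerXsubC normrX.
under [X in _ * X * _]eq_bigr do rewrite hornerXsubC.
apply: AP => //; rewrite leq_subRL//.
exact: leq_trans (leq_addr _ _) km.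
Qed.

(** The order of magnitude N ln N of all error terms. *)
Definition log_scale N : R := N.+1%:R * (1 + ln N.+1%:R).
Local Notation L := log_scale.

Definition log_max k : R := if (k < K0)%N then 0 else ln (D k).

Let ln_S_ge0 N : 0 <= ln N.+1%:R :> R.
Proof. by rewrite ln_ge0// ler1n. Qed.

Let ln_S_le k N : (k <= N)%N -> ln k.+1%:R <= ln N.+1%:R :> R.
Proof. by move=> kN; rewrite ler_ln ?posrE// ler_nat. Qed.

Let L_ge N : N.+1%:R <= L N.
Proof. by rewrite /L ler_peMr// lerDl. Qed.

Let L_ge1 N : 1 <= L N.
Proof. by apply: le_trans (L_ge N); rewrite ler1n. Qed.

(** The determinant bound involves D_(k-m) for k <= N, that is, it misses the
    last m maxima; each of them is at least exp(- b). *)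
Lemma sum_shift_le (f : nat -> R) (b : R) n j :
  f 0%N = 0 -> (forall k, (k < n)%N -> - f k <= b) -> 0 <= b ->
  \sum_(k < n) f (k - j)%N <= \sum_(k < n) f k + j%:R * b.
Proof.
move=> f0 fb b0; elim: j => [|j IH].
  by rewrite mul0r addr0; under eq_bigr do rewrite subn0.
apply: (@le_trans _ _ (\sum_(k < n) f (k - j)%N + b)); last first.
  by rewrite -natr1 mulrDl mul1r addrA lerD2r.
case: n fb {IH} => [|n] fb; first by rewrite !big_ord0 add0r.
rewrite big_ord_recl/= sub0n f0 add0r.
rewrite [leRHS](_ : _ = \sum_(k < n) f (k - j)%N + (f (n - j)%N + b)).
  rewrite lerDl -lerBlDl sub0r fb//; lia.
by rewrite big_ord_recr/= addrA.
Qed.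

Lemma ln_fact_le N : ln (N.+1)`!%:R <= L N.
Proof.
apply: (@le_trans _ _ (N.+1%:R * ln N.+1%:R)); last first.
  by rewrite /L mulrDr lerDr mulr1.
rewrite mulr_natl -lnXn// ler_ln ?posrE ?exprn_gt0 ?ltr0n ?fact_gt0//.
rewrite -natrX ler_nat; elim: N => // N IH.
by rewrite factS expnS leq_mul// (leq_trans IH)// leq_exp2r.
Qed.

Hypothesis K0_gt0 : (0 < K0)%N.

Lemma log_max_lower : exists2 c : R, 0 <= c &
  forall N k, (k < N.+1)%N -> - log_max k <= c * L N.
Proof.
have [c0 c00 cP] := node_max_lower.
exists (`|ln c0| + 17) => [|N k kN]; first by rewrite addr_ge0.
have L0 := L_ge1 N; have K16k := K16 k.
rewrite /log_max; case: ltnP => kK.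
  by rewrite oppr0 mulr_ge0// ?addr_ge0// (le_trans ler01).
have low : c0 * (16 * k.+1%:R) ^- k <= D k.
  apply: le_trans (cP k kK); rewrite ler_peMr ?node_scale_ge1//.
  by rewrite mulr_ge0 ?invr_ge0 ?exprn_ge0 ?ltW.
have : ln (c0 * (16 * k.+1%:R) ^- k) <= ln (D k).
  by rewrite ler_ln ?posrE ?node_max_gt0 ?mulr_gt0 ?invr_gt0 ?exprn_gt0.
rewrite lnM ?posrE ?invr_gt0 ?exprn_gt0// lnV ?posrE ?exprn_gt0// lnXn//.
rewrite lnM ?posrE// => h.
have ln16 : ln 16 <= 16 :> R by exact/ltW/ln_sublinear.
have lnk := @ln_S_le k N kN.
have h1 : (ln 16 + ln k.+1%:R) *+ k <= 17 * L N.
  rewrite -[_ *+ k]mulr_natl /L [leRHS]mulrCA; apply: ler_pM => //.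
  - by rewrite addr_ge0 ?ln_ge0// ler1n.
  - by rewrite ler_nat ltnW.
  - have := ln_S_ge0 N; lra.
have h2 : - ln c0 <= `|ln c0| * L N.
  apply: (@le_trans _ _ `|ln c0|); first by rewrite -normrN ler_norm.
  by rewrite ler_peMr.
by rewrite mulrDl; lra.
Qed.

Lemma ln_configuration_le : exists2 c : R, 0 <= c &
  forall N (x : 'I_N.+1 -> R), (forall j, I (x j)) ->
    0 < vandermonde x * \prod_j u (x j) ->
    ln (vandermonde x * \prod_j u (x j)) <=
      \sum_(k < N.+1) log_max k + c * L N.
Proof.
have [A [C [A3 C1 _ AC]]] := configuration_le_prod.
have [b b0 bP] := log_max_lower.
have A0 : 0 < A by lra.
have lnA0 : 0 <= ln A by rewrite ln_ge0//; lra.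
have lnC0 : 0 <= ln C by rewrite ln_ge0.
pose c := ln C + (2 * m)%:R * (ln A + 2).
have c0 : 0 <= c by rewrite /c addr_ge0// mulr_ge0// addr_ge0.
have mb0 : 0 <= m%:R * b by rewrite mulr_ge0.
exists (1 + c + m%:R * b); first lra.
move=> N x Ix V0.
have L1 := L_ge1 N; have L0 : 0 <= L N by exact: le_trans L1.
have sq0 k : 0 < A * k.+1%:R ^+ 2 by rewrite mulr_gt0// exprn_gt0.
have K0_sub k : (m + K0 <= k)%N -> (K0 <= k - m)%N.
  by move=> km; rewrite leq_subRL// (leq_trans (leq_addr _ _) km).
have tpos k : 0 < upper_factor A C k.
  rewrite /upper_factor; case: ltnP => km; first by lra.
  apply: mulr_gt0; first exact: exprn_gt0.
  exact/node_max_gt0/K0_sub.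
have tle k : (k < N.+1)%N ->
    ln (upper_factor A C k) <= c * (1 + ln N.+1%:R) + log_max (k - m).
  move=> kN; have lN := ln_S_ge0 N.
  rewrite /upper_factor /log_max; case: ltnP => km.
    have -> : (k - m < K0)%N by rewrite ltn_psubLR.
    rewrite addr0 /c mulrDl; apply: (@le_trans _ _ (ln C * (1 + ln N.+1%:R))).
      by rewrite ler_peMr// lerDl.
    by rewrite lerDl !mulr_ge0// addr_ge0.
  have -> : (k - m < K0)%N = false by rewrite ltnNge K0_sub.
  have Dkm : 0 < D (k - m) by exact/node_max_gt0/K0_sub.
  have sqX : 0 < (A * (k - m).+1%:R ^+ 2) ^+ (2 * m) by exact: exprn_gt0.
  rewrite (lnM sqX Dkm) lerD2r (lnXn _ (sq0 _)) -[_ *+ (2 * m)]mulr_natl.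
  rewrite lnM ?posrE ?exprn_gt0// lnXn//.
  apply: (@le_trans _ _ ((2 * m)%:R * (ln A + 2) * (1 + ln N.+1%:R))).
    rewrite -mulrA ler_wpM2l// mulr2n.
    have : ln (k - m).+1%:R <= ln N.+1%:R :> R.
      by apply: ln_S_le; rewrite -ltnS (leq_ltn_trans (leq_subr _ _) kN).
    nra.
  by rewrite ler_wpM2r ?addr_ge0// /c lerDr.
have f0 : 0 < (N.+1)`!%:R :> R by rewrite ltr0n fact_gt0.
have p0 : 0 < \prod_(k < N.+1) upper_factor A C k by exact: prodr_gt0.
have := AC N x Ix; rewrite -ler_ln ?posrE ?(mulr_gt0 f0 p0)// (lnM f0 p0).
move/le_trans; apply.
rewrite ln_prod => [|k]; last exact: tpos.
apply: (@le_trans _ _ (L N + (c * L N +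
    (\sum_(k < N.+1) log_max k + m%:R * (b * L N))))); last by lra.
apply: lerD; first exact: ln_fact_le.
apply: (@le_trans _ _ (\sum_(k < N.+1) (c * (1 + ln N.+1%:R) + log_max (k - m)))).
  by apply: ler_sum => k _; exact: tle.
rewrite big_split/= sumr_const card_ord -[_ *+ N.+1]mulr_natl mulrCA lerD2l.
apply: sum_shift_le; last by rewrite mulr_ge0.
- by rewrite /log_max K0_gt0.
- exact: bP.
Qed.

Definition leja_value N : R :=
  vandermonde (fun n : 'I_N.+1 => z n) * \prod_(j < N.+1) u (z j).
Local Notation W := leja_value.

(** As ln 0 = 0, the term of an index k with z k = a i disappears, so that this
    is the logarithm of the product over the points other than a i. *)
Definition log_distance i N : R := \sum_(k < N.+1) ln `|z k - a i|.
Local Notation S := log_distance.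

Hypothesis neg_sigma : \sum_i Num.max 0 (- sigma i) < 1.
Hypothesis z_singular :
  forall i, sigma i < 0 -> exists2 n, (n < K0)%N & z n = a i.

Lemma leja_valueE N : W N = \prod_(k < N.+1) (p k (z k) * u (z k)).
Proof. by rewrite /W vandermonde_greedy -big_split. Qed.

Let pu_gt0 k : 0 < p k (z k) * u (z k).
Proof. by rewrite mulr_gt0 ?u_gt0. Qed.

Lemma leja_value_gt0 N : 0 < W N.
Proof. by rewrite leja_valueE prodr_gt0. Qed.

Lemma sum_log_max_le : exists c : R, forall N, (K0 <= N)%N ->
  \sum_(k < N.+1) log_max k <= ln (W N) + \sum_i sigma i * S i N + c.
Proof.
pose l k := ln (p k (z k) * u (z k)) + \sum_i sigma i * ln `|z k - a i|.
have lD k : (K0 <= k)%N -> ln (D k) = l k.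
  move=> Kk; have := node_max_gt0 Kk; rewrite /D mulrCA mulrC.
  rewrite pmulr_rgt0// => g0; rewrite lnM ?posrE//; congr (_ + _).
  have fi i : 0 < `|z k - a i| `^ sigma i.
    rewrite lt0r powR_ge0 andbT; move: g0; rewrite lt0r => /andP[+ _].
    by move=> /prodf_neq0; apply.
  by rewrite /g ln_prod//; apply: eq_bigr => i _; rewrite ln_powR.
exists (\sum_(k < K0) `|l k|) => N KN.
have -> : ln (W N) + \sum_i sigma i * S i N = \sum_(k < N.+1) l k.
  rewrite leja_valueE ln_prod// /l big_split/=; congr (_ + _).
  by rewrite exchange_big/=; apply: eq_bigr => i _; rewrite mulr_sumr.
rewrite (big_ord_widen N.+1 (fun k => `|l k|)); last exact: leqW.
rewrite [X in _ <= _ + X]big_mkcond -big_split/=; apply: ler_sum => k _.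
rewrite /log_max; case: ltnP => kK; last by rewrite addr0 lD.
by rewrite -lerBlDl sub0r -normrN ler_norm.
Qed.

Lemma log_distance_le : exists2 c : R, 0 <= c & forall N i, S i N <= c * L N.
Proof.
have [A [_ [A3 _ zA _]]] := configuration_le_prod.
pose A' := A + \sum_(k < K0) (1 + `|z k|).
have s0 : 0 <= \sum_(k < K0) (1 + `|z k|).
  by apply: sumr_ge0 => k _; rewrite addr_ge0.
have A'1 : 1 <= A' by rewrite /A'; lra.
have zA' k : 1 + `|z k| <= A' * k.+1%:R ^+ 2.
  have k1 : 1 <= k.+1%:R ^+ 2 :> R by rewrite exprn_ege1// ler1n.
  have [kK|kK] := ltnP k K0; last first.
    by apply: le_trans (zA k kK) _; rewrite ler_wpM2r /A'; lra.
  apply: (@le_trans _ _ A'); last by rewrite ler_peMr//; lra.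
  rewrite /A' (bigD1 (Ordinal kK))//=.
  have : 0 <= \sum_(i < K0 | i != Ordinal kK) (1 + `|z i|).
    by apply: sumr_ge0 => i _; rewrite addr_ge0.
  by lra.
have lnA' : 0 <= ln A' by exact: ln_ge0.
exists (ln A' + 2) => [|N i]; first by lra.
apply: (@le_trans _ _ (\sum_(k < N.+1) ((ln A' + 2) * (1 + ln N.+1%:R)))); last first.
  by rewrite sumr_const card_ord -[_ *+ N.+1]mulr_natl mulrCA.
apply: ler_sum => k _; have lN := ln_S_ge0 N.
have [->|za] := eqVneq `|z k - a i| 0; first by rewrite ln0 ?mulr_ge0//; lra.
have za0 : 0 < `|z k - a i| by rewrite lt0r za normr_ge0.
have k0 : 0 < k.+1%:R :> R by [].
have kN : ln k.+1%:R <= ln N.+1%:R :> R by apply: ln_S_le; rewrite -ltnS.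
have : ln `|z k - a i| <= ln (A' * k.+1%:R ^+ 2).
  have := le_trans (norm_sub_le (z k) i) (zA' k).
  by rewrite ler_ln ?posrE// mulr_gt0 ?exprn_gt0//; lra.
rewrite lnM ?posrE ?exprn_gt0//; last by lra.
by rewrite lnXn// mulr2n; nra.
Qed.

Lemma replace_point N (n : 'I_N.+2) y :
  let xi := fun k : 'I_N.+2 => if k == n then y else z k in
  W N.+1 * (u y * \prod_(k < N.+1) `|y - z (lift n k)|) =
  (vandermonde xi * \prod_j u (xi j)) *
    (u (z n) * \prod_(k < N.+1) `|z n - z (lift n k)|).
Proof.
move=> xi; rewrite /W !(vandermonde_lift _ n) !(bigD1_ord n)//= /xi eqxx.
have li k : (lift n k == n) = false by rewrite eq_sym (negbTE (neq_lift _ _)).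
have -> : vandermonde ((fun k : 'I_N.+2 => if k == n then y else z k) \o lift n)
    = vandermonde ((fun k : 'I_N.+2 => z k) \o lift n).
  by congr vandermonde; apply/funext => k /=; rewrite li.
have -> : \prod_(k < N.+1) `|y - (if lift n k == n then y else z (lift n k))|
    = \prod_(k < N.+1) `|y - z (lift n k)|.
  by apply: eq_bigr => k _; rewrite li.
have -> : \prod_(k < N.+1) u (if lift n k == n then y else z (lift n k))
    = \prod_(k < N.+1) u (z (lift n k)).
  by apply: eq_bigr => k _; rewrite li.
rewrite /=; ring.
Qed.

(** If a i is itself one of the points, moving it to a place well separated
    from the others gives an admissible configuration, whose value is at most M;
    in the exchange the factors |a i - z k| are traded for factors that are at
    least 1 / (16 (N + 2)). *)
Lemma leja_value_le_distance : exists2 c : R, 0 <= c & forall N n i M,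
  (0 < N)%N -> (n <= N)%N -> z n = a i ->
  (forall x : 'I_N.+1 -> R, (forall j, I (x j)) ->
     vandermonde x * \prod_j u (x j) <= M) ->
  ln (W N) <= ln M + S i N + c * L N.
Proof.
exists (`|ln cu| + \sum_i `|ln (u (a i))| + 32).
  by rewrite !addr_ge0// sumr_ge0.
move=> [//|N] n i M _ nN zn MP.
have WM : W N.+1 <= M by apply: MP => j; exact: z_I.
have W0 := leja_value_gt0 N.+1.
have M0 : 0 < M := lt_le_trans W0 WM.
have [y y12 yz] := exists_separated N.+2 z.
have Iy := I_sub y12.
have nN' : (n < N.+2)%N by rewrite ltnS.
pose n' := Ordinal nN'.
have := replace_point n' y; set xi := fun _ => _ => /= eW.
have xiM : vandermonde xi * \prod_j u (xi j) <= M.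
  by apply: MP => j; rewrite /xi; case: ifP.
pose P := \prod_(k < N.+1) `|z n - z (lift n' k)|.
have uz : 0 < u (z n) by exact: u_gt0.
have Pi k : 0 < `|z n - z (lift n' k)|.
  have : 0 < vandermonde (fun k : 'I_N.+2 => z k).
    by move: W0; rewrite /W pmulr_lgt0//; apply: prodr_gt0 => j _; exact: u_gt0.
  rewrite (vandermonde_lift _ n') lt0r mulf_eq0 negb_or => /andP[/andP[+ _] _].
  by move=> /prodf_neq0 /(_ k isT); rewrite normr_gt0 normr_eq0.
have P0 : 0 < P by exact: prodr_gt0.
have Q0 : 0 < (16 * N.+3%:R) ^- N.+1 :> R by rewrite invr_gt0 exprn_gt0.
have h1 : W N.+1 * (cu * (16 * N.+3%:R) ^- N.+1) <= M * (u (z n) * P).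
  apply: (@le_trans _ _ (W N.+1 * (u y * \prod_(k < N.+1) `|y - z (lift n' k)|))).
    rewrite ler_pM2l//; apply: ler_pM => //; try exact: ltW.
      by apply: u_lower => //; rewrite ger0_norm; lra.
    have -> : (16 * N.+3%:R) ^- N.+1 = \prod_(k < N.+1) (16 * N.+3%:R)^-1 :> R.
      by rewrite prodr_const card_ord exprVn.
    apply: ler_prod => k _; rewrite invr_ge0 mulr_ge0//=.
    apply: le_trans (yz (lift n' k) (ltn_ord _)).
    by rewrite ler_peMl ?invr_ge0// lerDl.
  by rewrite eW ler_pM2r// mulr_gt0.
have SE : S i N.+1 = \sum_(k < N.+1) ln `|z n - z (lift n' k)|.
  rewrite /S (bigD1_ord n')//= zn subrr normr0 ln0// add0r.
  by apply: eq_bigr => k _; rewrite distrC.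
have cQ0 := mulr_gt0 cu_gt0 Q0; have uP0 := mulr_gt0 uz P0.
move: h1; rewrite -ler_ln ?posrE ?(mulr_gt0 W0 cQ0) ?(mulr_gt0 M0 uP0)//.
rewrite (lnM W0 cQ0) (lnM M0 uP0) (lnM cu_gt0 Q0) (lnM uz P0).
rewrite lnV ?posrE ?exprn_gt0// lnXn// /P ln_prod// -SE zn.
rewrite [ln (16 * _)]lnM ?posrE// => h1.
have uai : ln (u (a i)) <= \sum_i `|ln (u (a i))|.
  rewrite (bigD1 i)//=; have := ler_norm (ln (u (a i))).
  have : 0 <= \sum_(j | j != i) `|ln (u (a j))| by exact: sumr_ge0.
  by lra.
have lcu : - ln cu <= `|ln cu| by rewrite -normrN ler_norm.
have ln32 : ln 32 <= 32 :> R by exact/ltW/ln_sublinear.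
have lN := ln_S_ge0 N.+1.
have h2 : (ln 16 + ln N.+3%:R) *+ N.+1 <= 32 * L N.+1.
  apply: (@le_trans _ _ (ln (32 * N.+2%:R) *+ N.+1)).
    rewrite lerMn2r -lnM ?posrE//= ler_ln ?posrE ?mulr_gt0//.
    rewrite -[N.+3%:R]natr1.
    by have : 1 <= N.+2%:R :> R; [rewrite ler1n|lra].
  rewrite lnM ?posrE// -[_ *+ _]mulr_natl /L [leRHS]mulrCA; apply: ler_pM => //.
  - by rewrite addr_ge0// ln_ge0// ler1n.
  - by rewrite ler_nat.
  - by lra.
have L1 := L_ge1 N.+1.
have s0 : 0 <= \sum_i `|ln (u (a i))| by exact: sumr_ge0.
have h3 : \sum_i `|ln (u (a i))| <= (\sum_i `|ln (u (a i))|) * L N.+1.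
  by rewrite ler_peMr.
have h4 : `|ln cu| <= `|ln cu| * L N.+1 by rewrite ler_peMr.
by rewrite !mulrDl; lra.
Qed.

Definition configuration_values N : set R :=
  [set vandermonde x * \prod_j u (x j) |
    x in [set x : 'I_N.+1 -> R | forall j, I (x j)]].

Lemma configuration_bounded N : has_ubound (configuration_values N).
Proof.
have [A [C [_ _ _ AC]]] := configuration_le_prod.
exists ((N.+1)`!%:R * \prod_(k < N.+1) upper_factor A C k) => _ [x Ix <-].
exact: AC.
Qed.

(** The excess r = ln M - ln W occurs on both sides of the final inequality, on
    the right with a coefficient s < 1 coming from the negative exponents; solve
    for r. *)
Theorem configuration_le_leja_value : exists c : R, forall N, (K0 <= N)%N ->
  forall x : 'I_N.+1 -> R, (forall j, I (x j)) ->
  vandermonde x * \prod_j u (x j) <= W N * expR (c * L N).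
Proof.
have [c1 c10 c1P] := ln_configuration_le.
have [c2 c2P] := sum_log_max_le.
have [c3 c30 c3P] := log_distance_le.
have [c4 c40 c4P] := leja_value_le_distance.
pose s := \sum_i Num.max 0 (- sigma i).
pose s' := \sum_i `|sigma i|.
have s0 : 0 < 1 - s by rewrite subr_gt0.
have s'0 : 0 <= s' by exact: sumr_ge0.
pose C := c1 + `|c2| + s' * (c3 + c4).
exists (C / (1 - s)) => N KN x Ix.
pose M := sup (configuration_values N).
have bN := configuration_bounded N.
have xM (y : 'I_N.+1 -> R) :
    (forall j, I (y j)) -> vandermonde y * \prod_j u (y j) <= M.
  by move=> Iy; apply: ub_le_sup => //; exists y.
have W0 := leja_value_gt0 N.
have WM : W N <= M by apply: xM => j; exact: z_I.
have M0 : 0 < M := lt_le_trans W0 WM.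
have L1 := L_ge1 N.
have lnM_le : ln M <= \sum_(k < N.+1) log_max k + c1 * L N.
  rewrite -ler_expR lnK ?posrE//; apply: ge_sup.
    by exists (W N); exists (fun n : 'I_N.+1 => z n) => // j; exact: z_I.
  move=> _ [y Iy <-]; have [v0|v0] := leP (vandermonde y * \prod_j u (y j)) 0.
    by apply: le_trans v0 _; exact: expR_ge0.
  by rewrite -ler_ln ?posrE ?expR_gt0// expRK c1P.
pose r := ln M - ln (W N).
have r0 : 0 <= r by rewrite subr_ge0 ler_ln ?posrE.
(* only the negative exponents bring in r, through the moved point *)
have sS : \sum_i sigma i * S i N <= s * r + s' * (c3 + c4) * L N.
  rewrite /s /s' -mulrA !mulr_suml -big_split/=; apply: ler_sum => i _.
  have L0 : 0 <= L N by lra.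
  have [si|si] := leP 0 (sigma i).
    rewrite max_l; last by lra.
    rewrite mul0r add0r ger0_norm// ler_wpM2l//.
    by apply: le_trans (c3P N i) _; rewrite ler_wpM2r//; lra.
  rewrite max_r ?ltr0_norm//; last by lra.
  have [n nK zn] := z_singular si.
  have N0 : (0 < N)%N by exact: leq_trans KN.
  have nN : (n <= N)%N by exact: leq_trans (ltnW nK) KN.
  have := c4P N n i M N0 nN zn xM => h.
  rewrite -mulrDr -mulrNN ler_wpM2l//; first by lra.
  have : 0 <= c3 * L N by exact: mulr_ge0.
  by rewrite mulrDl /r; lra.
have c2L : c2 <= `|c2| * L N.
  by apply: le_trans (ler_norm _) _; rewrite ler_peMr.
have rC : r * (1 - s) <= C * L N.
  have rE : ln M = r + ln (W N) by rewrite /r subrK.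
  have -> : C * L N = c1 * L N + `|c2| * L N + s' * (c3 + c4) * L N.
    by rewrite /C; ring.
  rewrite mulrBr mulr1 [r * s]mulrC.
  have := c2P N KN; move: lnM_le sS c2L; rewrite rE.
  by move=> *; lra.
have rL : r <= C / (1 - s) * L N by rewrite mulrAC ler_pdivlMr.
apply: le_trans (xM x Ix) _.
have e0 := expR_gt0 (C / (1 - s) * L N).
rewrite -ler_ln ?posrE ?(mulr_gt0 W0 e0)// (lnM W0 e0) expRK.
by move: rL; rewrite /r; lra.
Qed.

End FixedExponent.
End LejaGrowth.

(** * From near-optimality to the limit *)

Section FeketeLimit.
Variables (R : realType) (I : set R) (vt u : R -> R).
Variables (k : nat -> R) (z : nat -> R).
Hypothesis vt_gt0 : forall x, I x -> 0 < vt x.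
Hypothesis z_I : forall n, I (z n).
Hypothesis k_gt0 : forall N, (0 < N)%N -> 0 < k N.
Hypothesis k_I : forall N x, (0 < N)%N -> I x -> I (k N * x).
Hypothesis k_divI : forall N x, (0 < N)%N -> I x -> I (x / k N).
Hypothesis vt_u : forall N x, (0 < N)%N -> I x -> vt (k N * x) ^+ N = u x.
Hypothesis values_bounded : forall N, has_ubound (configuration_values I u N).
Variables (c : R) (K0 : nat).
Hypothesis almost_optimal : forall N, (K0 <= N)%N ->
  forall x : 'I_N.+1 -> R, (forall j, I (x j)) ->
    vandermonde x * \prod_j u (x j) <= leja_value u z N * expR (c * log_scale R N).

(* the factor, depending on N only, by which the dilation by k N changes all
   Vandermonde products of N + 1 points *)
Let scale N : R := \prod_(i < N.+1) \prod_(j < N.+1 | (i < j)%N) k N.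

Let scale_gt0 N : (0 < N)%N -> 0 < scale N.
Proof.
by move=> N0; apply: prodr_gt0 => i _; apply: prodr_gt0 => j _; exact: k_gt0.
Qed.

Lemma weighted_vandermonde_scale N (x : 'I_N.+1 -> R) : (0 < N)%N ->
  (forall j, I (x j)) ->
  weighted_vandermonde vt (fun j => k N * x j) =
  scale N * (vandermonde x * \prod_j u (x j)).
Proof.
move=> N0 Ix; rewrite /weighted_vandermonde mulrA; congr (_ * _); last first.
  by apply: eq_bigr => j _; rewrite vt_u.
rewrite /vandermonde /scale -big_split/=; apply: eq_bigr => i _.
rewrite -big_split/=; apply: eq_bigr => j _.
by rewrite -mulrBr normrM gtr0_norm ?k_gt0.
Qed.

Lemma weighted_vandermonde_unscale N (x : 'I_N.+1 -> R) : (0 < N)%N ->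
  (forall j, I (x j)) ->
  weighted_vandermonde vt x =
  scale N * (vandermonde (fun j => x j / k N) * \prod_j u (x j / k N)).
Proof.
move=> N0 Ix; rewrite -weighted_vandermonde_scale// => [|j]; last exact: k_divI.
congr weighted_vandermonde; apply/funext => j.
by rewrite mulrC divfK// gt_eqF ?k_gt0.
Qed.

Lemma vandermonde_values_bounded N : (0 < N)%N ->
  has_ubound (vandermonde_values I vt N).
Proof.
move=> N0; have [b bP] := values_bounded N; exists (scale N * b) => _ [x Ix <-].
rewrite weighted_vandermonde_unscale// ler_pM2l ?scale_gt0//; apply: bP.
by exists (fun j => x j / k N) => // j; exact: k_divI.
Qed.

Lemma log_scale_cvg :
  expR (- (c * log_scale R N * fekete_exponent R N)) @[N --> \oo] --> (1 : R).
Proof.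
have -> : (1 : R) = expR (- 0) by rewrite oppr0 expR0.
apply: continuous_cvg; first exact: continuous_expR.
apply: cvgN; rewrite -[X in _ --> X](mulr0 c).
under eq_cvg do rewrite -mulrA.
apply: cvgMr; apply/cvgr0Pnorm_le => e e0.
near=> N.
have N0 : (0 < N)%N by near: N; exact: nbhs_infty_gt.
have N1 : 1 <= N%:R :> R by rewrite ler1n.
have NR : 0 < N%:R :> R by lra.
have lN : 0 <= ln N.+1%:R :> R by rewrite ln_ge0// ler1n.
have -> : log_scale R N * fekete_exponent R N = 2 * (1 + ln N.+1%:R) / N%:R.
  rewrite /log_scale /fekete_exponent natrD natrX -natr1; field.
  by rewrite !gt_eqF//; nra.
rewrite ger0_norm; last by rewrite divr_ge0// mulr_ge0// addr_ge0.
rewrite ler_pdivrMr//.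
pose s := Num.sqrt (N%:R : R).
have s1 : 1 <= s by rewrite -[leLHS]sqrtr1 ler_wsqrtr.
have ss : s ^+ 2 = N%:R by rewrite sqr_sqrtr// ltW.
have sN : Num.sqrt N.+1%:R <= 2 * s.
  rewrite -(@ler_pXn2r _ 2)// ?nnegrE ?sqrtr_ge0//; last by lra.
  by rewrite sqr_sqrtr// exprMn ss -natr1; lra.
have lns : ln N.+1%:R <= 2 * (2 * s).
  by apply: le_trans (ln_le_sqrt _) _ => //; rewrite ler_pM2l.
(* 2 (1 + ln (N + 1)) <= 2 (1 + 4 s) <= 10 s, with s = sqrt N *)
apply: (@le_trans _ _ (10 * s)); first by lra.
rewrite -ss expr2 mulrA ler_pM2r; last by lra.
rewrite -(@ler_pXn2r _ 2)// ?nnegrE; [|lra|nra].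
rewrite exprMn ss -ler_pdivrMl ?exprn_gt0//.
by near: N; exact: nbhs_infty_ger.
Unshelve. all: by end_near.
Qed.

(** Squeeze: the value of the dilated array lies between exp(- c L_N) times the
    supremum and the supremum, and L_N is o(N^2). *)
Theorem scaled_leja_fekete :
  asymptotically_fekete I vt (fun (N : nat) (n : 'I_N.+1) => k N * z n).
Proof.
have I0 : I !=set0 by exists (z 0%N).
have dcvg := is_cvg_transfinite_diameter vt_gt0 I0 vandermonde_values_bounded.
rewrite /asymptotically_fekete /transfinite_diameter.
apply: (@squeeze_cvgr _ _ _ _ (fun N =>
    expR (- (c * log_scale R N * fekete_exponent R N)) *
    transfinite_diameter_at I vt N) (transfinite_diameter_at I vt)) => //; last first.
  rewrite -[X in _ --> X]mul1r; apply: cvgM => //; exact: log_scale_cvg.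
near=> N.
have N0 : (0 < N)%N by near: N; exact: nbhs_infty_gt.
have KN : (K0 <= N)%N by near: N; exact: nbhs_infty_ge.
set X := weighted_vandermonde vt _; set e := fekete_exponent R N.
have e0 : 0 <= e by rewrite divr_ge0.
rewrite /transfinite_diameter_at -/(vandermonde_values _ _ _).
set Y := sup _.
have X0 : 0 <= X.
  by apply: (weighted_vandermonde_ge0 vt_gt0) => j; exact: (k_I N0 (z_I _)).
have XY : X <= Y.
  apply: ub_le_sup; first exact: vandermonde_values_bounded.
  by exists (fun j : 'I_N.+1 => k N * z j) => // j; exact: (k_I N0 (z_I _)).
have Y0 : 0 <= Y by exact: le_trans XY.
have YX : Y <= X * expR (c * log_scale R N).
  apply: ge_sup.
    exists X; exists (fun j : 'I_N.+1 => k N * z j) => // j.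
    exact: (k_I N0 (z_I _)).
  move=> _ [x Ix <-]; rewrite weighted_vandermonde_unscale//.
  rewrite /X weighted_vandermonde_scale// -mulrA ler_pM2l ?scale_gt0//.
  by apply: almost_optimal => // j; exact: k_divI.
apply/andP; split; last by apply: ge0_ler_powR.
rewrite expRN ler_pdivrMl ?expR_gt0//.
apply: (@le_trans _ _ ((X * expR (c * log_scale R N)) `^ e)).
  by apply: ge0_ler_powR; rewrite ?nnegrE ?(mulr_ge0 X0 (expR_ge0 _)).
by rewrite powRM ?expR_ge0// -expRM mulrC.
Unshelve. all: by end_near.
Qed.

End FeketeLimit.

(** * Leja sequences are greedy sequences *)

Section LejaObjective.
Variables (R : realType) (J : finType) (I S : set R) (w u : R -> R).
Variables (a sigma : J -> R) (z : nat -> R) (cu Cu : R).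
Local Notation g := (singular_factor a sigma).
Local Notation p := (node_product z).

Hypothesis I_sub : forall y, 1 / 4 <= y <= 1 / 2 -> I y.
Hypothesis a_le1 : forall i, `|a i| <= 1.
Hypothesis a_far : forall i y, 1 / 4 <= y <= 1 / 2 -> 1 / 4 <= `|y - a i|.
Hypothesis a_inj : injective a.
Hypothesis a_I : forall i, I (a i).
Hypothesis a_limit : forall i (e : R), 0 < e ->
  exists y, [/\ I y, y != a i & `|a i - y| < e].
Hypothesis cu_gt0 : 0 < cu.
Hypothesis u_gt0 : forall x, I x -> 0 < u x.
Hypothesis u_lower : forall x, I x -> `|x| <= 2 -> cu <= u x.
Hypothesis u_upper : forall x, I x -> u x <= Cu * expR (- (`|x| / 2)).
Hypothesis neg_sigma : \sum_i Num.max 0 (- sigma i) < 1.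
Hypothesis S_def : forall x, S x <-> exists2 i, x = a i & sigma i < 0.
Hypothesis sqrt_w : forall x, I x -> Num.sqrt (w x) = g x * u x.
Hypothesis z_leja : weighted_leja I S w z.

Local Notation F := (leja_objective I S w z).

Lemma powR_small (t : R) (e : R) : 0 < t -> 0 < e ->
  exists2 d : R, 0 < d & forall x, 0 <= x <= d -> x `^ t <= e.
Proof.
move=> t0 e0; exists (e `^ t^-1); first exact: powR_gt0.
move=> x /andP[x0 xd]; have -> : e = (e `^ t^-1) `^ t.
  by rewrite -powRrM mulVf ?gt_eqF// powRr1// ltW.
by apply: ge0_ler_powR; rewrite ?nnegrE ?powR_ge0 ?(ltW t0).
Qed.

Lemma cvg_prod_dist (T : finType) (P : pred T) (b s : T -> R) (x : R) :
  (forall i, P i -> x != b i) ->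
  \prod_(i | P i) `|y - b i| `^ s i @[y --> x] --> \prod_(i | P i) `|x - b i| `^ s i.
Proof.
move=> xb; apply: cvg_big => [|i Pi]; first exact: mul_continuous.
have n0 : 0 < `|x - b i| by rewrite normr_gt0 subr_eq0 xb.
have h : {for `|x - b i|, continuous (@powR R ^~ (s i))}.
  apply: differentiable_continuous; apply/derivable1_diffP/derivable_powR.
  by rewrite in_itv/= n0.
have hn : `|y - b i| @[y --> x] --> `|x - b i|.
  by apply: cvg_norm; apply: cvgB; [exact: cvg_id|exact: cvg_cst].
exact: (cvg_comp _ _ hn h).
Qed.

Lemma within_proper i : ProperFilter (within I (a i)^').
Proof.
apply: Build_ProperFilter => /nbhs_ballP[e /= e0 eP].
by have [y [Iy ya yd]] := a_limit i e0; exact: eP ya Iy.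
Qed.

Lemma objective_regular N x : I x -> ~ S x ->
  F N x = (g x * u x * p N.+1 x)%:E.
Proof.
by move=> Ix Sx; rewrite /leja_objective asboolF// sqrt_w.
Qed.

Lemma objective_singular N i (l : \bar R) : sigma i < 0 ->
  (g y * u y * p N.+1 y)%:E @[y --> within I (a i)^'] --> l -> F N (a i) = l.
Proof.
move=> si gl; rewrite /leja_objective asboolT; last first.
  by apply/S_def; exists i.
have := within_proper i => PF.
apply: cvg_lim => //; apply: cvg_trans gl; apply: near_eq_cvg.
rewrite near_withinE; apply: filterE => y Iy; by rewrite sqrt_w.
Qed.

Lemma near_punctured (x : R) (P : set R) :
  (\forall y \near x, P y) -> \forall y \near x^', P y.
Proof. by move=> xP; rewrite /dnbhs near_withinE; apply: filterS xP. Qed.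

Lemma near_norm_le2 i : \forall y \near (a i), `|y| <= 2.
Proof.
apply/nbhs_ballP; exists 1 => //= y; rewrite /ball/= => ay.
have := ler_normB (a i) (a i - y); rewrite subKr; have := a_le1 i; lra.
Qed.

(** Near a i the objective is |x - a i|^(sigma i) times a factor that stays away
    from 0. *)
Lemma objective_new N i : sigma i < 0 -> (forall n, (n <= N)%N -> z n <> a i) ->
  F N (a i) = +oo%E.
Proof.
move=> si zN; apply: objective_singular => //.
have [c c0 cP] : exists2 c : R, 0 < c & \forall y \near (a i),
    c <= (\prod_(j | j != i) `|y - a j| `^ sigma j) * p N.+1 y.
  pose l := (\prod_(j | j != i) `|a i - a j| `^ sigma j) * p N.+1 (a i).
  have l0 : 0 < l.
    rewrite mulr_gt0//; apply: prodr_gt0 => j.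
      by move=> ji; rewrite powR_gt0// normr_gt0 subr_eq0 (inj_eq a_inj) eq_sym.
    move=> _; rewrite normr_gt0 subr_eq0; apply/negP => /eqP e.
    by apply: (zN j) => //; rewrite -ltnS.
  exists (l / 2); first lra.
  have : (\prod_(j | j != i) `|y - a j| `^ sigma j) * p N.+1 y @[y --> a i] --> l.
    apply: cvgM.
      by apply: cvg_prod_dist => j ji; rewrite (inj_eq a_inj) eq_sym.
    have e y : p N.+1 y = \prod_(n < N.+1) `|y - z n| `^ 1.
      by apply: eq_bigr => n _; rewrite powRr1.
    rewrite e; under eq_cvg do rewrite e.
    apply: cvg_prod_dist => n _; apply/eqP => e'.
    by apply: (zN n) => //; rewrite -ltnS.
  move=> /cvgr_gt /(_ (l / 2)) h; have l2 : l / 2 < l by lra.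
  by apply: filterS (h l2) => y /ltW.
apply/cvgeyPge => A.
have B0 : 0 < (c * cu) / (`|A| + 1) by rewrite divr_gt0 ?mulr_gt0// ltr_wpDl.
have ns0 : 0 < - sigma i by lra.
have [d d0 dP] := powR_small ns0 B0.
rewrite near_withinE; near=> y => Iy.
have ya : y != a i by near: y; exact: nbhs_dnbhs_neq.
have cy : c <= (\prod_(j | j != i) `|y - a j| `^ sigma j) * p N.+1 y.
  by near: y; apply: near_punctured; exact: cP.
have y2 : `|y| <= 2 by near: y; apply: near_punctured; exact: near_norm_le2.
have yd : `|y - a i| <= d.
  near: y; apply: near_punctured; apply/nbhs_ballP; exists d => //= y.
  by rewrite /ball/= distrC => /ltW.
have y0 : 0 < `|y - a i| by rewrite normr_gt0 subr_eq0.
have uy := u_lower Iy y2.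
rewrite lee_fin /singular_factor (bigD1 i)//=.
have := dP `|y - a i|; rewrite (ltW y0) yd powRN => /(_ isT).
set t := `|y - a i| `^ sigma i.
have t0 : 0 < t by exact: powR_gt0.
move=> tB; have {}tB : `|A| + 1 <= t * (c * cu).
  by move: tB; rewrite ler_pdivlMr ?ltr_wpDl// ler_pdivrMl.
apply: (@le_trans _ _ (t * (c * cu))); first by have := ler_norm A; lra.
have -> : forall P, t * P * u y * p N.+1 y = t * (P * p N.+1 y * u y).
  by move=> P; ring.
by rewrite ler_pM2l//; apply: ler_pM => //; exact: ltW.
Unshelve. all: by end_near.
Qed.

Lemma sigma_gtN1 i : - 1 < sigma i.
Proof.
rewrite ltrNl; apply: le_lt_trans neg_sigma; rewrite (bigD1 i)//=.
by apply: ler_wpDr; [apply: sumr_ge0 => j _|]; rewrite le_max lexx ?orbT.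
Qed.

(** The factor |x - z n| = |x - a i| raises the exponent to sigma i + 1 > 0,
    and the other factors stay bounded. *)
Lemma objective_old N n i : sigma i < 0 -> (n <= N)%N -> z n = a i ->
  F N (a i) = 0%E.
Proof.
move=> si nN zn; apply: objective_singular => //.
pose G y := (\prod_(j | j != i) `|y - a j| `^ sigma j) *
  (\prod_(k < N.+1 | k != Ordinal (nN : (n < N.+1)%N)) `|y - z k|).
have [C C0 CP] : exists2 C : R, 0 < C & \forall y \near (a i), `|G y| <= C.
  pose l := G (a i).
  have Gl : G y @[y --> a i] --> l.
    apply: cvgM.
      by apply: cvg_prod_dist => j ji; rewrite (inj_eq a_inj) eq_sym.
    apply: cvg_big => [|k _]; first exact: mul_continuous.
    by apply: cvg_norm; apply: cvgB; [exact: cvg_id|exact: cvg_cst].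
  exists (`|l| + 1); first by rewrite ltr_wpDl.
  have l1 : `|l| < `|l| + 1 by lra.
  have nGl : `|G y| @[y --> a i] --> `|l| by exact: cvg_norm.
  by move/cvgr_le: nGl => /(_ _ l1).
apply: cvg_EFin; first by apply: filterE.
apply/cvgrPdist_le => e e0.
have B0 : 0 < e / (C * (`|Cu| + 1)) by rewrite divr_gt0// mulr_gt0// ltr_wpDl.
have s0 : 0 < sigma i + 1 by have := sigma_gtN1 i; lra.
have [d d0 dP] := powR_small s0 B0.
rewrite near_withinE; near=> y => Iy.
have ya : y != a i by near: y; exact: nbhs_dnbhs_neq.
have Gy : `|G y| <= C by near: y; apply: near_punctured; exact: CP.
have yd : `|y - a i| <= d.
  near: y; apply: near_punctured; apply/nbhs_ballP; exists d => //= y.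
  by rewrite /ball/= distrC => /ltW.
have y0 : 0 < `|y - a i| by rewrite normr_gt0 subr_eq0.
have uy : u y <= `|Cu| + 1.
  apply: le_trans (u_upper Iy) _; apply: (@le_trans _ _ `|Cu|); last by rewrite lerDl.
  apply: (@le_trans _ _ (`|Cu| * expR (- (`|y| / 2)))).
    by rewrite ler_wpM2r ?expR_ge0// ler_norm.
  by rewrite ler_piMr// expR_le1 oppr_le0 divr_ge0.
rewrite /= sub0r normrN.
have -> : g y * u y * p N.+1 y = `|y - a i| `^ (sigma i + 1) * (G y * u y).
  rewrite powRD ?(gt_eqF y0) ?implybT// powRr1// /G /singular_factor.
  rewrite /node_product (bigD1 i)//= [in LHS](bigD1 (Ordinal (nN : (n < N.+1)%N)))//=.
  by rewrite zn; ring.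
rewrite normrM ger0_norm ?powR_ge0//.
have := dP `|y - a i|; rewrite (ltW y0) yd => /(_ isT) h.
apply: (@le_trans _ _ (e / (C * (`|Cu| + 1)) * (C * (`|Cu| + 1)))).
  apply: ler_pM; rewrite ?powR_ge0//.
  by rewrite normrM; apply: ler_pM => //; rewrite ger0_norm// ltW// u_gt0.
by rewrite divfK// gt_eqF// mulr_gt0// ltr_wpDl.
Unshelve. all: by end_near.
Qed.

(** Compare with a test point separated from all earlier ones. *)
Lemma objective_gt0 N : (0%E < F N (z N.+1))%E.
Proof.
have [y y12 yp] := node_product_separated z N.+1.
have Iy := I_sub y12; have [_ /(_ N)[[_ zmax] _]] := z_leja.
apply: lt_le_trans (zmax y Iy).
have ya i : 0 < `|y - a i| by have := a_far i y12; lra.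
rewrite objective_regular//; last first.
  by move=> /S_def[i yi _]; have := ya i; rewrite yi subrr normr0 ltxx.
rewrite lte_fin !mulr_gt0 ?u_gt0//.
  by apply: prodr_gt0 => i _; exact: powR_gt0.
apply: lt_le_trans yp; rewrite mulr_gt0 ?invr_gt0 ?exprn_gt0 ?mulr_gt0//.
exact: lt_le_trans (node_scale_ge1 z _).
Qed.

Lemma leja_in n : I (z n).
Proof. by have [z0 zN] := z_leja; case: n => // n; case: (zN n) => -[]. Qed.

(** At a point chosen before, singular or not, the objective is 0. *)
Lemma leja_neq m n : (m < n)%N -> z n != z m.
Proof.
case: n => // n mn; apply/eqP => e; have := objective_gt0 n.
have [/S_def[i zi si]|Sz] := pselect (S (z n.+1)).
  by rewrite zi (@objective_old n m) ?ltxx -?zi ?e.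
rewrite objective_regular//; last exact: leja_in.
suff -> : p n.+1 (z n.+1) = 0 by rewrite mulr0 ltxx.
by rewrite /node_product (bigD1 (Ordinal mn))//= e subrr normr0 mul0r.
Qed.

Lemma leja_node_product_gt0 k : 0 < p k (z k).
Proof. by apply: prodr_gt0 => n _; rewrite normr_gt0 subr_eq0 leja_neq. Qed.

(** As long as a i has not been chosen, the objective is infinite there, so
    that the points chosen are singular too; being distinct, they would exhaust
    the finitely many singular points. *)
Lemma leja_visits_singular i : sigma i < 0 -> exists n, z n = a i.
Proof.
move=> si; apply: contrapT => nz.
have zS N : exists j, z N.+1 = a j.
  have [_ /(_ N)[[Iz zmax] _]] := z_leja.
  have := zmax (a i) (a_I i); rewrite objective_new// => [|n _ zn]; last first.
    by apply: nz; exists n.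
  rewrite leye_eq => /eqP Fz.
  have [/S_def[j zj _]|Sz] := pselect (S (z N.+1)); first by exists j.
  by move: Fz; rewrite objective_regular.
have [f fP] := choice zS.
have : injective (fun k : 'I_#|J|.+1 => f k).
  move=> k l /(congr1 a); rewrite -!fP => e; apply/val_inj/eqP.
  rewrite /= -[_ == _]negbK neq_ltn; apply/negP => /orP[kl|kl].
    by have := @leja_neq k.+1 l.+1 kl; rewrite e eqxx.
  by have := @leja_neq l.+1 k.+1 kl; rewrite e eqxx.
by move/leq_card; rewrite card_ord ltnn.
Qed.

Lemma leja_visits_all_singular : exists2 K0, (0 < K0)%N &
  forall i, sigma i < 0 -> exists2 n, (n < K0)%N & z n = a i.
Proof.
have /choice[f fP] : forall i, exists n, sigma i < 0 -> z n = a i.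
  move=> i; have [/leja_visits_singular[n zn]|si] := pselect (sigma i < 0).
    by exists n.
  by exists 0%N.
exists (\max_i f i).+1 => // i /fP zi; exists (f i) => //.
by rewrite ltnS leq_bigmax.
Qed.

(** Once all singular points have been chosen, the extended objective vanishes
    there, so the maximizer is a regular point; at a singular y the left-hand
    side is 0 by the convention 0 `^ t = 0 for t <> 0. *)
Lemma leja_maximal K0 k y : (0 < K0)%N ->
  (forall i, sigma i < 0 -> exists2 n, (n < K0)%N & z n = a i) ->
  (K0 <= k)%N -> I y ->
  p k y * (g y * u y) <= p k (z k) * (g (z k) * u (z k)).
Proof.
move=> K00 zS K0k Iy; case: k K0k => [|N K0k]; first by rewrite leqNgt K00.
have [_ /(_ N)[[Iz zmax] _]] := z_leja.
have Sz : ~ S (z N.+1).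
  move=> /S_def[i zi si]; have [n nK zn] := zS i si.
  have := objective_gt0 N; rewrite zi (@objective_old N n)// ?ltxx//.
  by rewrite -ltnS (leq_trans nK).
have [/S_def[i yi si]|Sy] := pselect (S y).
  rewrite yi /singular_factor (bigD1 i)//= subrr normr0 powR0 ?lt_eqF//.
  rewrite !mul0r mulr0 mulr_ge0 ?node_product_ge0// mulr_ge0 ?(ltW (u_gt0 _))//.
  by apply: prodr_ge0 => j _; exact: powR_ge0.
have := zmax y Iy; rewrite !objective_regular// lee_fin.
by rewrite ![p _ _ * _]mulrC.
Qed.

Theorem leja_almost_optimal :
  (forall N, has_ubound (configuration_values I u N)) /\
  exists (c : R) (K0 : nat), forall N, (K0 <= N)%N ->
    forall x : 'I_N.+1 -> R, (forall j, I (x j)) ->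
    vandermonde x * \prod_j u (x j) <= leja_value u z N * expR (c * log_scale R N).
Proof.
have [K0 K00 zS] := leja_visits_all_singular.
have [m0 m00 sm] := exponent_bound sigma.
have zmax k y := @leja_maximal K0 k y K00 zS.
have znew := leja_node_product_gt0; have zI := leja_in.
split=> [N|].
  exact: (configuration_bounded I_sub a_le1 a_far cu_gt0 u_gt0 u_lower u_upper
    zI zmax m00 sm).
have [c cP] := configuration_le_leja_value I_sub a_le1 a_far cu_gt0 u_gt0 u_lower
  u_upper zI znew zmax m00 sm K00 neg_sigma zS.
by exists c, K0.
Qed.

Variables (vt : R -> R) (k : nat -> R).
Hypothesis vt_gt0 : forall x, I x -> 0 < vt x.
Hypothesis k_gt0 : forall N, (0 < N)%N -> 0 < k N.
Hypothesis k_I : forall N x, (0 < N)%N -> I x -> I (k N * x).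
Hypothesis k_divI : forall N x, (0 < N)%N -> I x -> I (x / k N).
Hypothesis vt_u : forall N x, (0 < N)%N -> I x -> vt (k N * x) ^+ N = u x.

Theorem factored_weight_fekete :
  asymptotically_fekete I vt (fun (N : nat) (n : 'I_N.+1) => k N * z n).
Proof.
have [bounded [c [K0 optimal]]] := leja_almost_optimal.
exact: (scaled_leja_fekete vt_gt0 leja_in k_gt0 k_I k_divI vt_u bounded optimal).
Qed.

End LejaObjective.

(** * Hermite, Laguerre and Jacobi weights *)

Section Cases.
Variable R : realType.
Implicit Types (x t : R).

Lemma sqrt_powR x t : Num.sqrt (x `^ (2 * t)) = x `^ t.
Proof.
by rewrite -powR12_sqrt ?powR_ge0// -powRrM mulrAC divff ?mul1r.
Qed.

Lemma sqrt_expR x : Num.sqrt (expR x) = expR (x / 2).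
Proof. by rewrite -powR12_sqrt ?expR_ge0// -expRM. Qed.

Lemma big_unit (F : unit -> R) : \prod_i F i = F tt.
Proof. by rewrite (bigD1 tt)//= big1 ?mulr1// => -[]. Qed.

Lemma sum_unit (F : unit -> R) : \sum_i F i = F tt.
Proof. by rewrite (bigD1 tt)//= big1 ?addr0// => -[]. Qed.

(** For alpha >= 1 one has |x|^alpha >= |x| - 1, whence the exponential bound
    on u. *)
Lemma hermite_fekete (alpha mu : R) (z : nat -> R) :
  1 <= alpha -> - (1 / 2) < mu ->
  weighted_leja (case_interval (GenHermite alpha mu))
    (case_singular (GenHermite alpha mu)) (case_weight (GenHermite alpha mu)) z ->
  asymptotically_fekete (case_interval (GenHermite alpha mu))
    (case_vtilde (GenHermite alpha mu))
    (fun (N : nat) (n : 'I_N.+1) => case_contraction (GenHermite alpha mu) N * z n).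
Proof.
move=> al mu2 leja; have a0 : 0 < alpha by lra.
apply: (@factored_weight_fekete R unit _ _ _
  (fun x => expR (- (1 / 2 * `|x| `^ alpha))) (fun=> 0) (fun=> mu) z
  (expR (- (1 / 2 * 2 `^ alpha))) (expR (1 / 2)) _ _ _ _ _ _ _ _ _ _ _ _ _ leja) => /=.
- by [].
- by move=> _; rewrite normr0.
- by move=> _ y y12; rewrite subr0 ger0_norm; lra.
- by move=> [] [].
- by [].
- move=> _ e e0; exists (e / 2); split=> //; first by rewrite gt_eqF; lra.
  by rewrite sub0r normrN gtr0_norm; lra.
- exact: expR_gt0.
- by move=> x _; exact: expR_gt0.
- move=> x _ x2; rewrite ler_expR lerN2 ler_pM2l; last by lra.
  by apply: ge0_ler_powR; rewrite ?nnegrE// ltW.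
- move=> x _; rewrite -expRD ler_expR.
  suff : `|x| - 1 <= `|x| `^ alpha by lra.
  have [x1|x1] := leP 1 `|x|; last by have := powR_ge0 `|x| alpha; lra.
  by have := le1r_powR x1 al; lra.
- by rewrite sum_unit gt_max; lra.
- by move=> x; split=> [[-> ?]|[_ ->]//]; exists tt.
- move=> x _; rewrite /singular_factor big_unit subr0 sqrtrM ?powR_ge0//.
  by rewrite sqrt_powR sqrt_expR; congr (_ * expR _); field.
- by move=> x _; exact: expR_gt0.
- by move=> N N0; rewrite powR_gt0 ?ltr0n.
- by [].
- by [].
- move=> N x N0 _; rewrite -expRM_natl normrM powRM// ger0_norm ?powR_ge0//.
  rewrite -powRrM mulNr divfK ?gt_eqF// powR_inv1//; congr expR; field.
  by rewrite pnatr_eq0 -lt0n.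
Qed.

Lemma laguerre_fekete (s : R) (z : nat -> R) : -1 < s ->
  weighted_leja (case_interval (Laguerre s))
    (case_singular (Laguerre s)) (case_weight (Laguerre s)) z ->
  asymptotically_fekete (case_interval (Laguerre s))
    (case_vtilde (Laguerre s))
    (fun (N : nat) (n : 'I_N.+1) => case_contraction (Laguerre s) N * z n).
Proof.
move=> s1 leja.
apply: (@factored_weight_fekete R unit _ _ _
  (fun x => expR (- (1 / 2 * x))) (fun=> 0) (fun=> s / 2) z
  (expR (- 1)) 1 _ _ _ _ _ _ _ _ _ _ _ _ _ leja) => /=.
- by move=> y; lra.
- by move=> _; rewrite normr0.
- by move=> _ y y12; rewrite subr0 ger0_norm; lra.
- by move=> [] [].
- by [].
- move=> _ e e0; exists (e / 2); split; first by lra.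
    by rewrite gt_eqF; lra.
  by rewrite sub0r normrN gtr0_norm; lra.
- exact: expR_gt0.
- by move=> x _; exact: expR_gt0.
- by move=> x x0; rewrite ger0_norm// ler_expR; lra.
- by move=> x x0; rewrite ger0_norm// [1 * expR _]mul1r ler_expR; lra.
- by rewrite sum_unit gt_max; lra.
- move=> x; split=> [[-> s0]|[_ -> s0]]; first by exists tt => //; lra.
  by split=> //; lra.
- move=> x x0; rewrite /singular_factor big_unit subr0 ger0_norm//.
  rewrite sqrtrM ?powR_ge0// -[s in LHS](@divfK _ 2)// [s / 2 * 2]mulrC.
  by rewrite sqrt_powR sqrt_expR; congr (_ * expR _); field.
- by move=> x _; exact: expR_gt0.
- by move=> N N0; rewrite invr_gt0 ltr0n.
- by move=> N x N0 x0; rewrite mulr_ge0.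
- by move=> N x N0 x0; rewrite invrK mulr_ge0.
- move=> N x N0 _; rewrite -expRM_natl; congr expR; field.
  by rewrite pnatr_eq0 -lt0n.
Qed.

Lemma jacobi_fekete (alpha beta : R) (z : nat -> R) : -1 < alpha -> -1 < beta ->
  weighted_leja (case_interval (Jacobi alpha beta))
    (case_singular (Jacobi alpha beta)) (case_weight (Jacobi alpha beta)) z ->
  asymptotically_fekete (case_interval (Jacobi alpha beta))
    (case_vtilde (Jacobi alpha beta))
    (fun (N : nat) (n : 'I_N.+1) => case_contraction (Jacobi alpha beta) N * z n).
Proof.
move=> al1 be1 leja.
apply: (@factored_weight_fekete R bool _ _ _
  (fun=> 1) (fun b => if b then 1 else -1) (fun b => (if b then alpha else beta) / 2) z
  1 (expR (1 / 2)) _ _ _ _ _ _ _ _ _ _ _ _ _ leja) => /=.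
- by move=> y; lra.
- by move=> []; rewrite ?normrN normr1.
- by move=> [] y y12; [rewrite ler0_norm; lra|rewrite ger0_norm; lra].
- by move=> [] [] //; lra.
- by move=> []; lra.
- move=> b e e0; pose d := Num.min 1 (e / 2).
  have d0 : 0 < d by rewrite lt_min; lra.
  have d1 : d <= 1 by rewrite ge_min lexx.
  have de : d < e by rewrite gt_min; apply/orP; right; lra.
  case: b; [exists (1 - d)|exists (d - 1)]; split.
  + by lra.
  + by rewrite lt_eqF; lra.
  + by rewrite ger0_norm; lra.
  + by lra.
  + by rewrite gt_eqF; lra.
  + by rewrite ler0_norm; lra.
- exact: ltr01.
- by move=> _ _; exact: ltr01.
- by [].
- move=> x; rewrite -ler_norml => x1.
  by rewrite -expRD; have := expR_ge1Dx (1 / 2 - `|x| / 2); lra.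
- by rewrite big_bool/= !maxEle; do 2 case: ifP; lra.
- move=> x; split=> [[[-> h]|[-> h]]|[[] -> h]].
  + by exists true => //; lra.
  + by exists false => //; lra.
  + by left; split=> //; lra.
  + by right; split=> //; lra.
- move=> x x1; rewrite /singular_factor big_bool mulr1.
  have -> : `|x - 1| = 1 - x by rewrite ler0_norm; lra.
  have -> : `|x - -1| = 1 + x by rewrite ger0_norm; lra.
  rewrite sqrtrM ?powR_ge0//.
  rewrite -{1}[alpha](@divfK _ 2)// -{1}[beta](@divfK _ 2)//.
  by rewrite ![_ / 2 * 2]mulrC !sqrt_powR.
- by move=> _ _; exact: ltr01.
- by move=> _ _; exact: ltr01.
- by move=> N x _; rewrite mul1r.
- by move=> N x _; rewrite divr1.
- by move=> N x _ _; rewrite expr1n.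
Qed.

End Cases.

Theorem theorem3p2 (R : realType) (c : weight_case R) (z : nat -> R) :
  admissible c ->
  weighted_leja (case_interval c) (case_singular c) (case_weight c) z ->
  asymptotically_fekete (case_interval c) (case_vtilde c)
    (fun (N : nat) (n : 'I_N.+1) => case_contraction c N * z n).
Proof.
case: c => [alpha mu [al mu2]|s s1|alpha beta [al be]].
- exact: hermite_fekete.
- exact: laguerre_fekete.
- exact: jacobi_fekete.
Qed.
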